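(* Fix $r\in\mathbb{N}$, $r\ge 2$, and let $G=G^{(n)}$ be a random DFA with state set $V=[n]$ and alphabet $[r]$, $n\to\infty$. There exist random variables $\Lambda=\Lambda^{(n)}\in(0,1)$ (measurable with respect to $G$) such that $$\Lambda\, n \overset{\mathbb{P}}{\longrightarrow} 1,$$ and, for every $\varepsilon>0$, w.h.p., $$\sup_{t\ge 0}\ \max_{x,y\in V}\ \frac{\mathbf{P}_{(x,y)}(\tau_{\rm meet}>t)}{(1-\Lambda)^t}<1+\varepsilon .$$
   Context: Random DFA: for integers $2\le r\le n$, let $V=[n]=\{1,\dots,n\}$ (states) and $\mathcal{C}=[r]=\{1,\dots,r\}$ (colors/letters). A DFA is a triple $(V,\mathcal{C},\{f_x\}_{x\in V})$ with each $f_x:\mathcal{C}\to V$ one-to-one; it is identified with the directed graph with an edge $x\to f_x(c)$ of color $c$ for all $x\in V$, $c\in\mathcal{C}$ (self-loops allowed, no multiple directed edges). The random DFA $G=G^{(n)}$ is obtained by choosing the $f_x$, $x\in V$, independently, each uniformly among the one-to-one maps $\mathcal{C}\to V$; its law is denoted $\mathbb{P}=\mathbb{P}^{(n)}$. Walks: given $G$, the random walk has transition matrix $P(x,y)=\frac1r\sum_{c\in\mathcal{C}}\mathbf{1}\{f_x(c)=y\}$ on $V$. Two independent synchronous walks form the product Markov chain $(X^{(1)}_t,X^{(2)}_t)_{t\in\mathbb{N}}$ on $V^2$ (here $\mathbb{N}=\{0,1,\dots\}$, and $t$ denotes discrete time) with transition matrix $P\otimes P$, and $\mathbf{P}_{(x,y)}$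 is its law, given $G$, when started from $(x,y)$. The meeting time is $\tau_{\rm meet}=\inf\{t\in\mathbb{N}: X^{(1)}_t=X^{(2)}_t\}$. Asymptotics: $r$ is fixed and $n\to\infty$. For $G$-measurable random variables $Y=Y^{(n)},Z=Z^{(n)}$, $Y\overset{\mathbb{P}}{\longrightarrow}Z$ means $\lim_{n\to\infty}\mathbb{P}(|Y-Z|>\epsilon)=0$ for all $\epsilon>0$. A sequence of events $\mathcal{E}^{(n)}$ occurs w.h.p. if $\mathbb{P}(\mathcal{E}^{(n)})\to1$. *)

(* Defs.v *)
From HB Require Import structures.
From mathcomp Require Import all_boot all_order all_algebra.
From mathcomp Require Import all_classical all_reals all_analysis.

Set Implicit Arguments.
Unset Strict Implicit.
Unset Printing Implicit Defensive.

Import Order.TTheory GRing.Theory Num.Theory.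
Import numFieldNormedType.Exports.

Local Open Scope classical_set_scope.
Local Open Scope ring_scope.

(* States are 'I_n and letters are 'I_r (numbered from 0). *)
Definition letter_map (n r : nat) : finType :=
  {f : {ffun 'I_r -> 'I_n} | injectiveb f}.

Definition dfa (n r : nat) : finType := {ffun 'I_n -> letter_map n r}.

Section RandomDfa.
Variables (R : realType) (r : nat).

Definition uniform_law (T : finType) (a : T) : R := (#|T|%:R)^-1.

(* Product of uniform laws: the maps f_x are independent, each uniform among
   the one-to-one maps. For n < r (and n > 0) there is no DFA and the law is
   an empty sum; only n >= r is meaningful. *)
Definition dfa_law (n : nat) (G : dfa n r) : R :=
  \prod_(x < n) uniform_law (G x).

Definition dfa_Pr (n : nat) (E : pred (dfa n r)) : R :=
  \sum_(G : dfa n r | E G) dfa_law G.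

Definition cvg_in_prob (Y Z : forall n, dfa n r -> R) : Prop :=
  forall eps : R, 0 < eps ->
    (fun n => dfa_Pr (fun G : dfa n r => eps < `|Y n G - Z n G|)) @ \oo --> 0.

Definition whp (E : forall n, pred (dfa n r)) : Prop :=
  (fun n => dfa_Pr (E n)) @ \oo --> (1 : R).

Definition walk_mx (n : nat) (G : dfa n r) : 'M[R]_n :=
  \matrix_(x, y) (r%:R^-1 * \sum_(c < r) (val (G x) c == y)%:R).

Definition pair_kernel (n : nat) (G : dfa n r) (z w : 'I_n * 'I_n) : R :=
  walk_mx G z.1 w.1 * walk_mx G z.2 w.2.

End RandomDfa.

(* Law of the trajectory (X_0, ..., X_T) of the Markov chain on S with
   transition kernel Q started from z. *)
Definition path_law (R : realType) (S : finType) (Q : S -> S -> R) (z : S)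
    (T : nat) (w : T.+1.-tuple S) : R :=
  (thead w == z)%:R *
  \prod_(s < T) Q (tnth w (widen_ord (leqnSn T) s)) (tnth w (lift ord0 s)).

(* First index s with X^(1)_s = X^(2)_s; by the convention of [find], it is
   T + 1 when the trajectory does not meet by time T, so that its value is
   min(tau_meet, T + 1). *)
Definition meet_time (n T : nat) (w : T.+1.-tuple ('I_n * 'I_n)) : nat :=
  find (fun z => z.1 == z.2) w.

(* P_(x,y)(tau_meet > t): this event is determined by (X_0, ..., X_t). *)
Definition meet_tail (R : realType) (r n : nat) (G : dfa n r)
    (x y : 'I_n) (t : nat) : R :=
  \sum_(w : t.+1.-tuple ('I_n * 'I_n) | (t < meet_time w)%N)
     path_law (@pair_kernel R r n G) (x, y) w.

(* Main.v *)
(* Only an upper bound on the tail is needed, so Lambda may be deterministic,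
   (1 - o(1)) / n.  As max_(x,y) P_(x,y)(tau > t) is submultiplicative in t, it
   suffices that, w.h.p., any two walks meet within T = o(n) steps with
   probability at least T Lambda.

   Mixing: the transition laws after O(log n) steps from any two states have a
   common mass n^(-c) with c < 1/4.  Indeed the out-balls of two states at a
   constant depth are usually disjoint; from there both explorations grow by a
   factor close to r until they have nearly n vertices, up to failures so rare
   that they occur for no pair, and then their images overlap.  An arbitrary
   state x reaches many states in O(log n) steps, and one of them has an
   out-ball disjoint from that of any given state.  Hence after n^(c + o(1))
   steps the starting states are forgotten, and they may be taken uniform.

   Meeting: from uniform states, the event that both walks visit 2t distinct
   states before time t and then meet has probability close to 1/n, averaged
   over G.  These events exclude each other for different t.  A second moment
   bound for their number shows that it is concentrated, because two pairs of
   walks of length o(n^(1/4)) rarely intersect.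

   Both parts reveal G step by step: if the set A(G) is determined by the
   restriction of G to it, then the values of G off A(G) can be resampled. *)

Require Import Defs.
From HB Require Import structures.
From mathcomp Require Import all_boot all_order all_algebra perm reals.
From mathcomp Require Import lra zify ring.

Set Implicit Arguments.
Unset Strict Implicit.
Unset Printing Implicit Defensive.

Import Order.TTheory GRing.Theory Num.Theory.

Local Open Scope ring_scope.

(** * Averages and resampling *)

(** No stationary law appears. A walk is driven by a word of letters chosen independently of G: for
    fixed words every position is a function of G, so moments over G are computed by revealing one
    map at a time, and the words are averaged afterwards. Sums over all starting states make
    collisions cheap: a start inside a given set costs as little as a step into it. Overlaps compare
    two laws at one exact time, hence the use of fronts of states reached in exactly a given number
    of steps, where balls would only bound that number. With b^100 <= n <= b^101, the overlap is at
    least b^-13 after at most b steps. This gives a burn-in s <= b^15, after which meetings are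
    counted during T = b^17 steps. So s / T <= b^-2 is negligible, while (s + T)^4 stays far below
    n, as the variance bound requires. The factor b / (b + 1) in the rate absorbs all the errors. *)

Section Mean.
Variables (R : realFieldType).

Definition mean (T : finType) (phi : T -> R) : R := #|T|%:R^-1 * \sum_x phi x.

Section MeanT.
Variable T : finType.
Implicit Types phi psi : T -> R.

Lemma eq_mean phi psi : phi =1 psi -> mean phi = mean psi.
Proof. by move=> e; rewrite /mean; congr (_ * _); apply: eq_bigr. Qed.

Lemma ler_mean phi psi : (forall x, phi x <= psi x) -> mean phi <= mean psi.
Proof.
move=> h; apply: ler_wpM2l; first by rewrite invr_ge0.
by apply: ler_sum.
Qed.

Lemma mean_ge0 phi : (forall x, 0 <= phi x) -> 0 <= mean phi.
Proof. by move=> h; apply: mulr_ge0; [rewrite invr_ge0 | apply: sumr_ge0]. Qed.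

Lemma meanZ c phi : mean (fun x => c * phi x) = c * mean phi.
Proof. by rewrite /mean -mulr_sumr mulrCA. Qed.

Lemma meanZr c phi : mean (fun x => phi x * c) = mean phi * c.
Proof. by rewrite mulrC -meanZ; apply: eq_mean => x; rewrite mulrC. Qed.

Lemma meanD phi psi : mean (fun x => phi x + psi x) = mean phi + mean psi.
Proof. by rewrite /mean big_split mulrDr. Qed.

Lemma meanB phi psi : mean (fun x => phi x - psi x) = mean phi - mean psi.
Proof. by rewrite /mean sumrB mulrBr. Qed.

Lemma mean_sum (I : Type) (s : seq I) (P : pred I) (phi : I -> T -> R) :
  mean (fun x => \sum_(i <- s | P i) phi i x) = \sum_(i <- s | P i) mean (phi i).
Proof. by rewrite /mean exchange_big /= mulr_sumr. Qed.

Lemma mean_cst c : (0 < #|T|)%N -> mean (fun _ : T => c) = c.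
Proof.
move=> h; rewrite /mean sumr_const -[X in _ * X]mulr_natl mulrA mulVf ?mul1r //.
by rewrite pnatr_eq0 -lt0n.
Qed.

Lemma mean_exists (I : finType) (P : pred I) (E : I -> pred T) (W : T -> R) :
  (forall x, 0 <= W x) ->
  mean (fun x => W x * [exists (i | P i), E i x]%:R)
    <= \sum_(i | P i) mean (fun x => W x * (E i x)%:R).
Proof.
move=> W0; rewrite -mean_sum; apply: ler_mean => x.
rewrite -mulr_sumr; apply: ler_wpM2l => //.
case: existsP => [[i /andP[Pi Ei]]|_]; last by apply: sumr_ge0.
by rewrite (bigD1 i) //= Ei lerDl; apply: sumr_ge0.
Qed.

End MeanT.

Lemma mean_pair (S T : finType) (phi : S -> T -> R) :
  mean (fun p : S * T => phi p.1 p.2) = mean (fun x => mean (phi x)).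
Proof.
rewrite /mean card_prod natrM invfM -mulr_sumr -mulrA; congr (_ * (_ * _)).
by rewrite pair_bigA.
Qed.

End Mean.

(** * Stopping sets and conditional means *)

Section Resampling.
Variables (R : realFieldType) (V L : finType).
Local Notation D := {ffun V -> L}.
Implicit Types (G H : D) (A B : D -> {set V}).

Definition agree (A : {set V}) G H := forall z, z \in A -> G z = H z.

(* X only depends on G through its restriction to A(G); local A A says that A
   is a stopping set. *)
Definition local (T : Type) A (X : D -> T) :=
  forall G H, agree (A G) G H -> X H = X G.

Definition mix (A : {set V}) G H : D := [ffun z => if z \in A then G z else H z].

Lemma mix_agree (A : {set V}) G H : agree A G (mix A G H).
Proof. by move=> z zA; rewrite ffunE zA. Qed.

Lemma local_mix (T : Type) A (X : D -> T) G H : local A X -> X (mix (A G) G H) = X G.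
Proof. by apply; apply: mix_agree. Qed.

Lemma localW (T : Type) A B (X : D -> T) :
  (forall G, A G \subset B G) -> local A X -> local B X.
Proof. by move=> sAB h G H e; apply: h => z /(subsetP (sAB G)); apply: e. Qed.

Lemma local_comp (T U : Type) A (X : D -> T) (F : T -> U) :
  local A X -> local A (fun G => F (X G)).
Proof. by move=> h G H /h ->. Qed.

Lemma local_comp2 (T U W : Type) A (X : D -> T) (Y : D -> U) (F : T -> U -> W) :
  local A X -> local A Y -> local A (fun G => F (X G) (Y G)).
Proof. by move=> hX hY G H e; rewrite (hX _ _ e) (hY _ _ e). Qed.

(* Swapping G and H off A(G) is an involution of D * D, because A(G) can be
   read off the swapped pair. *)
Lemma mean_resample A (phi : D -> R) : local A A ->
  mean phi = mean (fun G => mean (fun H => phi (mix (A G) G H))).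
Proof.
move=> stA; rewrite -mean_pair /mean.
pose h (p : D * D) := (mix (A p.1) p.1 p.2, mix (A p.1) p.2 p.1).
have hK : involutive h.
  move=> [G H]; rewrite /h /= (local_mix _ _ stA).
  by congr (_, _); apply/ffunP => z; rewrite !ffunE; case: (z \in A G).
rewrite (reindex_inj (inv_inj hK)) /=.
have -> : \sum_(p : D * D) phi (mix (A (h p).1) (h p).1 (h p).2)
        = \sum_(p : D * D) phi p.1.
  apply: eq_bigr => -[G H] _; congr phi => /=; rewrite (local_mix _ _ stA).
  by apply/ffunP => z; rewrite !ffunE; case: (z \in A G).
rewrite -(pair_bigA _ (fun G _ => phi G)) /= card_prod natrM invfM.
have [D0|D0] := posnP #|{: D}|; first by rewrite D0 invr0 !mul0r.
have -> : \sum_(G : D) \sum_(H : D) phi G = #|{: D}|%:R * \sum_G phi G.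
  by rewrite mulr_sumr; apply: eq_bigr => G _; rewrite sumr_const mulr_natl.
by rewrite mulrA -(mulrA _^-1) mulVf ?mulr1 // pnatr_eq0 -lt0n.
Qed.

(** This is conditioning on the restriction of G to [A G]. The weight [W] is unchanged by resampling
    and leaves the inner mean, so [phi] is averaged for one frozen G at a time, and only where
    [W G != 0]. *)
Lemma mean_resample_le A (W : D -> R) (phi : D -> R) (c : R) : local A A -> local A W ->
  (forall G, 0 <= W G) ->
  (forall G, W G != 0 -> mean (fun H => phi (mix (A G) G H)) <= c) ->
  mean (fun G => W G * phi G) <= c * mean W.
Proof.
move=> stA locW W0 h; rewrite (mean_resample _ stA) -meanZ; apply: ler_mean => G.
under eq_mean => H do rewrite (local_mix _ _ locW).
rewrite meanZ mulrC; have [->|Wn0] := eqVneq (W G) 0; first by rewrite !mulr0.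
by apply: ler_wpM2r => //; apply: h.
Qed.

Lemma mean_resample_eq A (W : D -> R) (phi : D -> R) (c : R) : local A A -> local A W ->
  (forall G, W G != 0 -> mean (fun H => phi (mix (A G) G H)) = c) ->
  mean (fun G => W G * phi G) = c * mean W.
Proof.
move=> stA locW h; rewrite (mean_resample _ stA) -meanZ; apply: eq_mean => G.
under eq_mean => H do rewrite (local_mix _ _ locW).
rewrite meanZ mulrC; have [->|Wn0] := eqVneq (W G) 0; first by rewrite !mulr0.
by rewrite h.
Qed.

Lemma mean_prod_ffun (g : V -> L -> R) :
  mean (fun G : D => \prod_x g x (G x)) = \prod_x mean (g x).
Proof.
rewrite /mean -(bigA_distr_bigA (fun x l => g x l)) big_split /= card_ffun.
by rewrite prodr_const cardT natrX exprVn -cardT.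
Qed.

Lemma mean_prod_set (F : {set V}) (g : V -> L -> R) : (0 < #|L|)%N ->
  mean (fun G : D => \prod_(x in F) g x (G x)) = \prod_(x in F) mean (g x).
Proof.
move=> L0; rewrite [RHS]big_mkcond.
rewrite (eq_bigr (fun x => mean (fun l => if x \in F then g x l else 1))); last first.
  by move=> x _; case: ifP => // _; rewrite mean_cst.
by rewrite -mean_prod_ffun; apply: eq_mean => G; rewrite big_mkcond.
Qed.

End Resampling.

(** * A single random one-to-one map *)

Section Letters.
Variables (R : realFieldType) (n r : nat).
Hypothesis rn : (r <= n)%N.
Local Notation L := (letter_map n r).
Implicit Types (l : L) (B X : {set 'I_n}).

Definition succs l : {set 'I_n} := [set val l c | c : 'I_r].

Lemma card_succs l : #|succs l| = r.
Proof. by rewrite card_imset ?card_ord //; apply/injectiveP; apply: (valP l). Qed.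

Lemma card_letters_in B : #|[pred l : L | succs l \subset B]| = (#|B| ^_ r)%N.
Proof.
have := card_inj_ffuns_on 'I_r (mem B); rewrite !card_ord => <-.
rewrite -(card_image val_inj).
apply: eq_card => f; rewrite !inE; apply/imageP/andP => [[l] | [/ffun_onP fB fi]].
  rewrite !inE => /subsetP lB ->; split; last exact: (valP l).
  by apply/ffun_onP => c; apply: lB; apply: imset_f.
exists (exist (fun f : {ffun 'I_r -> 'I_n} => injectiveb f) f fi : L) => //; rewrite inE; apply/subsetP => _ /imsetP[c _ ->].
exact: fB.
Qed.

Lemma card_letter_map : #|{: L}| = (n ^_ r)%N.
Proof.
have -> : (n ^_ r = #|[set: 'I_n]| ^_ r)%N by rewrite cardsT card_ord.
rewrite -card_letters_in; apply: eq_card => l.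
by rewrite !inE subsetT.
Qed.

Lemma letter_map_gt0 : (0 < #|{: L}|)%N.
Proof. by rewrite card_letter_map ffact_gt0. Qed.

(** Factor by factor, (k - j) m <= k (m - j), also when the subtraction truncates: drawing without
    replacement stays inside a subset no more often than drawing with replacement. *)
Lemma ffact_ratio k m j : (k <= m)%N -> (k ^_ j * m ^ j <= k ^ j * m ^_ j)%N.
Proof.
move=> km; elim: j => [|j IH]; first by rewrite !expn0 !ffactn0.
rewrite !ffactnSr !expnSr.
have h : ((k - j) * m <= k * (m - j))%N by nia.
by rewrite mulnACA (mulnACA (k ^ j)%N) leq_mul.
Qed.

Lemma mean_succs_sub B :
  mean (fun l => (succs l \subset B)%:R) <= (#|B|%:R / n%:R) ^+ r :> R.
Proof.
have Bn : (#|B| <= n)%N by rewrite -[X in (_ <= X)%N]card_ord max_card.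
have -> : mean (fun l => (succs l \subset B)%:R) = (#|B| ^_ r)%:R / (n ^_ r)%:R :> R.
  rewrite /mean -card_letters_in -card_letter_map mulrC; congr (_ / _).
  by rewrite -sum1_card natr_sum [RHS]big_mkcond; apply: eq_bigr => l _; rewrite inE; case: ifP.
have [n0|n0] := posnP n.
  have -> : r = 0%N by move: rn n0; lia.
  by rewrite expr0 !ffactn0 divr1.
rewrite expr_div_n ler_pdivrMr ?ltr0n ?ffact_gt0 // mulrAC.
rewrite ler_pdivlMr ?exprn_gt0 ?ltr0n // -!natrX -!natrM ler_nat.
exact: ffact_ratio.
Qed.

(* Composing with a transposition of states permutes the one-to-one maps. *)
Lemma mean_letter_eq c (x y : 'I_n) :
  mean (fun l : L => (val l c == x)%:R) = mean (fun l : L => (val l c == y)%:R) :> R.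
Proof.
rewrite /mean; congr (_ * _); pose s := tperm x y.
have inj_sl (l : L) : injectiveb [ffun i => s (val l i)].
  apply/injectiveP => i j; rewrite !ffunE => /perm_inj.
  by move/(injectiveP _ (valP l)).
pose h l : L := exist (fun f : {ffun 'I_r -> 'I_n} => injectiveb f) _ (inj_sl l).
have hK : involutive h.
  move=> l; apply: val_inj; apply/ffunP => i; rewrite /h /= !ffunE.
  by rewrite /s tpermK.
rewrite (reindex_inj (inv_inj hK)) /=; apply: eq_bigr => l _.
by rewrite ffunE -(inj_eq (@perm_inj _ s)) /s tpermK tpermL.
Qed.

Lemma mean_letter c X :
  mean (fun l : L => (val l c \in X)%:R) = #|X|%:R / n%:R :> R.
Proof.
have one x : mean (fun l : L => (val l c == x)%:R) = n%:R^-1 :> R.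
  have n0 : n%:R != 0 :> R by rewrite pnatr_eq0 -lt0n (leq_ltn_trans _ (ltn_ord x)).
  apply: (mulIf n0); rewrite mulVf //.
  transitivity (\sum_(y : 'I_n) mean (fun l : L => (val l c == y)%:R) : R).
    rewrite (eq_bigr (fun=> mean (fun l : L => (val l c == x)%:R))); last first.
      by move=> y _; apply: mean_letter_eq.
    by rewrite sumr_const card_ord mulr_natr.
  rewrite -mean_sum -[RHS](@mean_cst R L) ?letter_map_gt0 //; apply: eq_mean => l.
  by rewrite (bigD1 (val l c)) //= eqxx big1 ?addr0 // => y; rewrite eq_sym => /negbTE ->.
transitivity (\sum_(x in X) mean (fun l : L => (val l c == x)%:R) : R); last first.
  by rewrite (eq_bigr _ (fun x _ => one x)) sumr_const mulr_natl.
rewrite -mean_sum; apply: eq_mean => l.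
have [lX|lX] := boolP (val l c \in X).
  by rewrite (bigD1 (val l c)) //= eqxx big1 ?addr0 // => y /andP[_]; rewrite eq_sym => /negbTE ->.
by rewrite big1 // => x xX; case: eqP => // e; rewrite e xX in lX.
Qed.

Lemma mean_succs_meet X :
  mean (fun l => (~~ [disjoint succs l & X])%:R) <= r%:R * #|X|%:R / n%:R :> R.
Proof.
apply: (@le_trans _ _ (\sum_(c < r) mean (fun l : L => (val l c \in X)%:R))).
  rewrite -mean_sum; apply: ler_mean => l.
  case: (boolP [disjoint _ & _]) => [_|/pred0Pn[_ /andP[/imsetP[c _ ->] /= cX]]].
    by apply: sumr_ge0.
  by rewrite (bigD1 c) //= cX lerDl; apply: sumr_ge0.
rewrite (eq_bigr _ (fun c _ => mean_letter c X)) sumr_const card_ord.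
by rewrite -[_ *+ r]mulr_natl mulrA.
Qed.

End Letters.

(** * Walks driven by fixed words *)

Section Walks.
Variables (R : realFieldType) (n r : nat).
Hypothesis rn : (r <= n)%N.
Local Notation V := 'I_n.
Local Notation L := (letter_map n r).
Local Notation D := {ffun V -> L}.
Implicit Types (G H : D) (a b : nat -> 'I_r) (u v z : V).

Definition step G z c : V := val (G z) c.

Fixpoint pos G u a i : V := if i is j.+1 then step G (pos G u a j) (a j) else u.

(** The states whose maps are read in order to reach [pos G u a i]. The position at time [i] is left
    out, because its own map is still unread. *)
Definition trace G u a i : seq V := mkseq (pos G u a) i.

Definition seqset (S : D -> seq V) G : {set V} := [set z in S G].

Lemma traceS G u a i : trace G u a i.+1 = rcons (trace G u a i) (pos G u a i).
Proof. by rewrite /trace /mkseq -addn1 iotaD map_cat cats1. Qed.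

Lemma mem_trace G u a i j : (j < i)%N -> pos G u a j \in trace G u a i.
Proof. by move=> ji; apply: map_f; rewrite mem_iota. Qed.

Lemma local_pos u a i : local (seqset (fun G => trace G u a i)) (fun G => pos G u a i).
Proof.
elim: i => [|i IH] G H //= e; rewrite (IH G H) /step ?e //.
  by rewrite inE mem_trace.
by move=> z zt; apply: e; move: zt; rewrite !in_set traceS mem_rcons in_cons => ->; rewrite orbT.
Qed.

Lemma local_traceS u a i : local (seqset (fun G => trace G u a i)) (fun G => trace G u a i.+1).
Proof.
move=> G H e; apply/eq_in_map => j; rewrite mem_iota add0n => /andP[_ ji].
apply: (local_pos (i := j)) => z; rewrite inE => /mapP[k]; rewrite mem_iota add0n => /andP[_ kj] ->.
by apply: e; rewrite inE mem_trace // (leq_trans kj).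
Qed.

Lemma local_trace u a i : local (seqset (fun G => trace G u a i)) (fun G => trace G u a i).
Proof.
case: i => // i; apply: localW (@local_traceS u a i) => G.
by apply/subsetP => z; rewrite !in_set traceS mem_rcons in_cons => ->; rewrite orbT.
Qed.

Lemma local_seqset S T (X : D -> T) : local (seqset S) X -> forall A,
  (forall G, {subset S G <= A G}) -> local (seqset A) X.
Proof. by move=> h A s; apply: localW h => G; apply/subsetP => z; rewrite !inE; apply: s. Qed.

Lemma local_cat S S' : local (seqset S) S -> local (seqset S') S' ->
  local (seqset (fun G => S G ++ S' G)) (fun G => S G ++ S' G).
Proof.
move=> h h'; apply: (local_comp2 cat).
  by apply: local_seqset h _ _ => G z zs; rewrite mem_cat zs.
by apply: local_seqset h' _ _ => G z zs; rewrite mem_cat zs orbT.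
Qed.

Lemma local_seqset_self S : local (seqset S) S -> local (seqset S) (seqset S).
Proof. by move=> h G H /h e; rewrite /seqset e. Qed.

Lemma card_seqset S G : (#|seqset S G| <= size (S G))%N.
Proof. by rewrite cardsE card_size. Qed.

Lemma mean_coord z (g : L -> R) : mean (fun H : D => g (H z)) = mean g.
Proof.
have := mean_prod_set [set z] (fun=> g) (letter_map_gt0 rn); rewrite big_set1 => <-.
by apply: eq_mean => H; rewrite big_set1.
Qed.

(** The map at [p G] lies off [A G], so it is resampled, and each of its letters leads to a uniform
    state. *)
Lemma mean_step A (W : D -> R) (p : D -> V) (X : D -> {set V}) c m :
  local A A -> local A W -> local A p -> local A X ->
  (forall G, W G != 0 -> p G \notin A G) -> (forall G, W G != 0 -> #|X G| = m) ->
  mean (fun G => W G * (step G (p G) c \in X G)%:R) = m%:R / n%:R * mean W.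
Proof.
move=> lA lW lp lX pA Xm.
apply: (mean_resample_eq (phi := fun G => (step G (p G) c \in X G)%:R) lA lW) => G W0.
under eq_mean => H do
  rewrite (local_mix _ _ lp) (local_mix _ _ lX) /step ffunE (negbTE (pA _ W0)).
by rewrite (mean_coord _ (fun l => (val l c \in X G)%:R)) mean_letter // Xm.
Qed.

Lemma mean_step_le A (W : D -> R) (p : D -> V) (X : D -> {set V}) c m :
  local A A -> local A W -> local A p -> local A X -> (forall G, 0 <= W G) ->
  (forall G, W G != 0 -> p G \notin A G) -> (forall G, W G != 0 -> (#|X G| <= m)%N) ->
  mean (fun G => W G * (step G (p G) c \in X G)%:R) <= m%:R / n%:R * mean W.
Proof.
move=> lA lW lp lX W0 pA Xm.
apply: (mean_resample_le (phi := fun G => (step G (p G) c \in X G)%:R) lA lW W0) => G Wn0.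
under eq_mean => H do
  rewrite (local_mix _ _ lp) (local_mix _ _ lX) /step ffunE (negbTE (pA _ Wn0)).
rewrite (mean_coord _ (fun l => (val l c \in X G)%:R)) mean_letter //.
by apply: ler_wpM2r; rewrite ?invr_ge0 // ler_nat Xm.
Qed.

(** The states before time [k] are distinct and off [S], so the step into time [k] reads a new map;
    it must hit [X] or close a cycle. *)
Definition enters (S : D -> seq V) (X : D -> {set V}) v b k G :=
  [&& uniq (trace G v b k), ~~ has (mem (S G)) (trace G v b k)
    & (pos G v b k \in X G) || (pos G v b k \in trace G v b k)].

Section Enter.
Variables (S : D -> seq V) (X : D -> {set V}) (W : D -> R) (m : nat).
Hypotheses (lS : local (seqset S) S) (lX : local (seqset S) X) (lW : local (seqset S) W).
Hypotheses (W0 : forall G, 0 <= W G) (Xm : forall G, (#|X G| <= m)%N).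

Lemma local_enters v b k t : (k < t)%N ->
  local (seqset (fun G => S G ++ trace G v b t)) (enters S X v b k).
Proof.
move=> kt G H e; rewrite /enters.
have eS : agree (seqset S G) G H by move=> z zS; apply: e; move: zS; rewrite !inE mem_cat => ->.
have et : agree (seqset (fun G => trace G v b k) G) G H.
  move=> z; rewrite inE => /mapP[j]; rewrite mem_iota add0n => /andP[_ jk] ->.
  by apply: e; rewrite inE mem_cat mem_trace ?orbT // (ltn_trans jk).
by rewrite (lS eS) (lX eS) (local_trace et) (local_pos et).
Qed.

(** At time 0 the sum over [v] counts the elements of [X G]. At a later time the last step is
    uniform and has at most [m + k] targets, and the [n] starting states cancel the denominator. *)
Lemma mean_enters b k :
  \sum_v mean (fun G => W G * (enters S X v b k G)%:R) <= (m + k)%:R * mean W.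
Proof.
case: k => [|k].
  rewrite -mean_sum addn0 -meanZ; apply: ler_mean => G.
  rewrite -mulr_sumr mulrC; apply: ler_wpM2r => //.
  under eq_bigr => v _ do rewrite /enters /= orbF.
  rewrite -natr_sum ler_nat (leq_trans _ (Xm G)) // -sum1_card [X in (_ <= X)%N]big_mkcond.
  by apply: leq_sum => v _; case: (v \in X G).
apply: (@le_trans _ _ (\sum_(v : V) ((m + k.+1)%:R / n%:R * mean W))); last first.
  rewrite sumr_const card_ord -[X in X <= _]mulr_natr mulrAC.
  move: (mean W) (mean_ge0 W0) => M M0.
  have [->|n0] := posnP n; first by rewrite invr0 mulr0 !mul0r; apply: mulr_ge0.
  by rewrite divfK // pnatr_eq0 -lt0n.
apply: ler_sum => v _.
pose A G := S G ++ trace G v b k.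
have lA : local (seqset A) A by apply: local_cat => //; apply: local_trace.
have lSA T (Y : D -> T) : local (seqset S) Y -> local (seqset A) Y.
  by move=> h; apply: local_seqset h _ _ => G z zs; rewrite mem_cat zs.
have lkA T (Y : D -> T) : local (seqset (fun G => trace G v b k)) Y -> local (seqset A) Y.
  by move=> h; apply: local_seqset h _ _ => G z zs; rewrite mem_cat zs orbT.
pose av G := uniq (trace G v b k.+1) && ~~ has (mem (S G)) (trace G v b k.+1).
have lav : local (seqset A) av.
  apply: (local_comp2 (fun t s => uniq t && ~~ has (mem s) t)).
    by apply: lkA; apply: local_traceS.
  exact: lSA.
pose X' G := X G :|: [set z in trace G v b k.+1].
have -> : mean (fun G => W G * (enters S X v b k.+1 G)%:R)
  = mean (fun G => W G * (av G)%:R * (step G (pos G v b k) (b k) \in X' G)%:R).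
  by apply: eq_mean => G; rewrite -mulrA -natrM mulnb /enters /av /X' !inE andbA.
apply: (le_trans (@mean_step_le (seqset A) (fun G => W G * (av G)%:R)
   (fun G => pos G v b k) X' (b k) (m + k.+1) _ _ _ _ _ _ _)).
- exact: local_seqset_self.
- by apply: (local_comp2 (fun x (y : bool) => x * y%:R)) => //; apply: lSA.
- by apply: lkA; apply: local_pos.
- apply: (local_comp2 (fun x y => x :|: [set z in y : seq V])); first exact: lSA.
  by apply: lkA; apply: local_traceS.
- by move=> G; apply: mulr_ge0.
- move=> G; rewrite /av; case: andP; last by rewrite mulr0 eqxx.
  rewrite traceS rcons_uniq has_rcons => -[/andP[h1 _]] /norP[h2 _] _.
  by rewrite inE mem_cat negb_or h1 andbT.
- move=> G _; apply: leq_trans (leq_card_setU _ _) _; apply: leq_add => //.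
  by rewrite (leq_trans (card_seqset (fun G => trace G v b k.+1) G)) // size_mkseq.
apply: ler_wpM2l; first by rewrite divr_ge0.
by apply: ler_mean => G; rewrite ler_piMr // lern1 leq_b1.
Qed.

Lemma mean_enters_before b t :
  \sum_v mean (fun G => W G * [exists k : 'I_t, enters S X v b k G]%:R)
    <= (t * (m + t))%:R * mean W.
Proof.
apply: (@le_trans _ _ (\sum_(k < t) \sum_v mean (fun G => W G * (enters S X v b k G)%:R))).
  rewrite exchange_big /=; apply: ler_sum => v _.
  exact: (mean_exists xpredT (fun k : 'I_t => enters S X v b k) W0).
apply: (@le_trans _ _ (\sum_(k < t) ((m + t)%:R * mean W))).
  apply: ler_sum => k _; apply: le_trans (mean_enters b k) _.
  by apply: ler_wpM2r; [apply: mean_ge0 | rewrite ler_nat leq_add2l ltnW].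
by rewrite sumr_const card_ord -[X in X <= _]mulr_natl mulrA natrM.
Qed.

End Enter.
End Walks.

(** * First and second moments of the number of meetings *)

Section Meetings.
Variables (R : realFieldType) (n r : nat).
Hypotheses (rn : (r <= n)%N) (n0 : (0 < n)%N).
Local Notation V := 'I_n.
Local Notation L := (letter_map n r).
Local Notation D := {ffun V -> L}.
Implicit Types (G H : D) (u v z : V).

Lemma dfa_gt0 : (0 < #|{: D}|)%N.
Proof. by rewrite card_ffun expn_gt0 letter_map_gt0. Qed.

(** Take the first time at which the trace repeats a state or meets [X]. Before it, a state in [S]
    would be in [X] by the hypothesis, so the walk has avoided [S] as well. *)
Lemma exists_enters (S : D -> seq V) (X : D -> {set V}) v b t G :
  {in trace G v b t, forall z, z \in S G -> z \in X G} ->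
  ~~ uniq (trace G v b t) || has (mem (X G)) (trace G v b t) ->
  [exists k : 'I_t, enters S X v b k G].
Proof.
elim: t => [|t IH] // SX h.
have sub : {subset trace G v b t <= trace G v b t.+1}.
  by move=> z zt; rewrite traceS mem_rcons in_cons zt orbT.
have [h1|] := boolP (~~ uniq (trace G v b t) || has (mem (X G)) (trace G v b t)).
  have /existsP[k hk] := IH (sub_in1 sub SX) h1.
  by apply/existsP; exists (widen_ord (leqnSn t) k).
rewrite negb_or negbK => /andP[ut nX]; apply/existsP; exists ord_max => /=.
rewrite /enters ut /=; apply/andP; split.
  apply: contra nX => /hasP[z zt zS]; apply/hasP; exists z => //.
  by apply: SX zS; apply: sub.
move: h; rewrite traceS rcons_uniq has_rcons negb_and negbK ut /= orbF.
by rewrite (negbTE nX) orbF orbC.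
Qed.

Variables a b : nat -> 'I_r.

Definition both u v t G := trace G u a t ++ trace G v b t.

Definition fresh_meet u v t G := uniq (both u v t G) && (pos G u a t == pos G v b t).

Lemma local_both u v t : local (seqset (both u v t)) (both u v t).
Proof. by apply: local_cat; apply: local_trace. Qed.

Lemma local_bothl T u v t (X : D -> T) :
  local (seqset (fun G => trace G u a t)) X -> local (seqset (both u v t)) X.
Proof. by move=> h; apply: local_seqset h _ _ => G z zs; rewrite mem_cat zs. Qed.

Lemma local_bothr T u v t (X : D -> T) :
  local (seqset (fun G => trace G v b t)) X -> local (seqset (both u v t)) X.
Proof. by move=> h; apply: local_seqset h _ _ => G z zs; rewrite mem_cat zs orbT. Qed.

Lemma local_fresh_meet u v t : local (seqset (both u v t)) (fresh_meet u v t).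
Proof.
apply: (local_comp2 (fun s e => uniq s && e)); first exact: local_both.
by apply: (local_comp2 (fun x y => x == y)); [apply: local_bothl | apply: local_bothr];
  apply: local_pos.
Qed.

Lemma size_both u v t G : size (both u v t G) = (t + t)%N.
Proof. by rewrite size_cat !size_mkseq. Qed.

Lemma mean1 : mean (fun _ : D => 1) = 1 :> R.
Proof. by rewrite mean_cst // dfa_gt0. Qed.

(** The first walk repeats a state, at total cost [t ^ 2] over its starts, or the second repeats a
    state or enters the trace of the first, at total cost [2 * t ^ 2]. The start of the other walk
    contributes the factor [n]. *)
Lemma sum_not_uniq t :
  \sum_u \sum_v mean (fun G => (~~ uniq (both u v t G))%:R) <= (n * (3 * t ^ 2))%:R :> R.
Proof.
pose e1 u G := [exists k : 'I_t, enters (fun=> [::]) (fun=> set0) u a k G].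
pose e2 u v G := [exists k : 'I_t, enters (fun G => trace G u a t)
   (seqset (fun G => trace G u a t)) v b k G].
have h u v G : (~~ uniq (both u v t G))%:R <= (e1 u G)%:R + (e2 u v G)%:R :> R.
  rewrite -natrD ler_nat; case: (boolP (uniq _)) => //= nu.
  suff : e1 u G || e2 u v G by case: (e1 _ _); case: (e2 _ _ _).
  move: nu; rewrite cat_uniq; case: (boolP (uniq (trace G u a t))) => /= [uu|nu _].
    rewrite negb_and negbK => nu; apply/orP; right.
    apply: exists_enters => [z _|]; first by rewrite inE.
    case/orP: nu => [/hasP[z z1 z2]|->//]; apply/orP; right.
    by apply/hasP; exists z => //=; rewrite in_set.
  by rewrite /e1 exists_enters // nu.
have le1 u : mean (fun G => (e1 u G)%:R) = mean (fun G => 1 * (e1 u G)%:R) :> R.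
  by apply: eq_mean => G; rewrite mul1r.
apply: (@le_trans _ _ (\sum_u \sum_v (mean (fun G => (e1 u G)%:R) + mean (fun G => 1 * (e2 u v G)%:R)))).
  apply: ler_sum => u _; apply: ler_sum => v _; rewrite -meanD; apply: ler_mean => G.
  by rewrite mul1r.
under eq_bigr => u _ do rewrite big_split /=.
rewrite big_split /= exchange_big /=.
have -> : (n * (3 * t ^ 2))%:R = (n * (t * (0 + t)))%:R + (n * (t * (t + t)))%:R :> R.
  by rewrite -natrD; congr (_%:R); ring.
apply: lerD.
  apply: (@le_trans _ _ (\sum_(v : V) (t * (0 + t))%:R)); last by rewrite sumr_const card_ord -[_ *+ n]mulr_natl -natrM.
  apply: ler_sum => _ _; rewrite (eq_bigr _ (fun u _ => le1 u)).
  apply: (@le_trans _ _ ((t * (0 + t))%:R * mean (fun _ : D => 1))); last by rewrite mean1 mulr1.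
  by apply: (@mean_enters_before R n r rn (fun=> [::]) (fun=> set0) (fun=> 1) 0) => // G; rewrite cards0.
apply: (@le_trans _ _ (\sum_(v : V) (t * (t + t))%:R)); last by rewrite sumr_const card_ord -[_ *+ n]mulr_natl -natrM.
apply: ler_sum => u _.
apply: (@le_trans _ _ ((t * (t + t))%:R * mean (fun _ : D => 1))); last by rewrite mean1 mulr1.
apply: (@mean_enters_before R n r rn (fun G => trace G u a t)
  (seqset (fun G => trace G u a t)) (fun=> 1) t) => //.
- exact: local_trace.
- by apply: local_seqset_self; apply: local_trace.
- by move=> G; rewrite (leq_trans (card_seqset _ G)) // size_mkseq.
Qed.

(** Everything is revealed except the last step of the second walk. When the states are distinct,
    this step reads a new map and hits the final position of the first walk with probability exactly
    1/n. *)
Lemma mean_fresh_meet u v t : (0 < t)%N ->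
  mean (fun G => (fresh_meet u v t G)%:R) = n%:R^-1 * mean (fun G => (uniq (both u v t G))%:R) :> R.
Proof.
case: t => // t _; pose S G := trace G u a t.+1 ++ trace G v b t.
have lS : local (seqset S) S by apply: local_cat; apply: local_trace.
have lSl T (X : D -> T) : local (seqset (fun G => trace G u a t.+1)) X -> local (seqset S) X.
  by move=> h; apply: local_seqset h _ _ => G z zs; rewrite mem_cat zs.
have lSr T (X : D -> T) : local (seqset (fun G => trace G v b t)) X -> local (seqset S) X.
  by move=> h; apply: local_seqset h _ _ => G z zs; rewrite mem_cat zs orbT.
rewrite -[n%:R^-1]mul1r.
rewrite -(@mean_step _ _ _ rn (seqset S) (fun G => (uniq (both u v t.+1 G))%:R)
  (fun G => pos G v b t) (fun G => [set pos G u a t.+1]) (b t) 1).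
- apply: eq_mean => G; rewrite inE -natrM mulnb eq_sym.
  by rewrite /fresh_meet [_ == step _ _ _]eq_sym.
- exact: local_seqset_self.
- apply: (local_comp2 (fun s s' => (uniq (s ++ s'))%:R)).
    by apply: lSl; apply: local_trace.
  by apply: lSr; apply: local_traceS.
- by apply: lSr; apply: local_pos.
- by apply: (local_comp (fun x => [set x])); apply: lSl; apply: local_pos.
- move=> G; case: (boolP (uniq _)) => [|_]; last by rewrite eqxx.
  rewrite /both (traceS G v) -cats1 catA cats1 rcons_uniq => /andP[h _] _.
  by rewrite inE.
- by move=> G _; rewrite cards1.
Qed.

Lemma sum_fresh_meet_le t : (0 < t)%N ->
  \sum_u \sum_v mean (fun G => (fresh_meet u v t G)%:R) <= n%:R :> R.
Proof.
move=> t0; apply: (@le_trans _ _ (\sum_(u : V) \sum_(v : V) n%:R^-1)).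
  apply: ler_sum => u _; apply: ler_sum => v _; rewrite mean_fresh_meet //.
  rewrite ler_piMr ?invr_ge0 // -[X in _ <= X]mean1; apply: ler_mean => G.
  by rewrite lern1 leq_b1.
rewrite !sumr_const card_ord -mulrnA -[X in X <= _]mulr_natl natrM -mulrA mulfV ?mulr1 //.
by rewrite pnatr_eq0 -lt0n.
Qed.

Lemma sum_fresh_meet_ge t : (0 < t)%N ->
  n%:R - (3 * t ^ 2)%:R <= \sum_u \sum_v mean (fun G => (fresh_meet u v t G)%:R) :> R.
Proof.
move=> t0; have nn0 : n%:R != 0 :> R by rewrite pnatr_eq0 -lt0n.
under eq_bigr => u _ do (under eq_bigr => v _ do rewrite mean_fresh_meet //; rewrite -mulr_sumr).
rewrite -mulr_sumr ler_pdivlMl ?ltr0n //.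
have := sum_not_uniq t.
have -> : \sum_u \sum_v mean (fun G => (~~ uniq (both u v t G))%:R)
   = (n * n)%:R - \sum_u \sum_v mean (fun G => (uniq (both u v t G))%:R) :> R.
  rewrite -[(n * n)%:R](_ : \sum_(u : V) \sum_(v : V) 1 = _); last first.
    by rewrite !sumr_const card_ord -mulrnA.
  rewrite -sumrB; apply: eq_bigr => u _; rewrite -sumrB; apply: eq_bigr => v _.
  rewrite -[X in X - _]mean1 -meanB; apply: eq_mean => G.
  by case: (uniq _); rewrite ?subrr ?subr0.
by rewrite natrM [X in _ <= X -> _]natrM; lra.
Qed.

(** * Correlation of the meetings of two pairs of walks *)

Section SecondMeeting.
Variables (u v : V) (t t' : nat).
Hypotheses (t'0 : (0 < t')%N).
Let W G : R := (fresh_meet u v t G)%:R.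
Let S G := both u v t G.
(** [e2]: the walk from [v'] enters the trace of the first pair or repeats a state. [e3] says this
    of the walk from [u']; there the trace from [v'] only counts as already read, since a fresh
    meeting keeps the two traces apart. *)
Let e2 v' G := [exists k : 'I_t', enters S (seqset S) v' b k G].
Let e3 u' v' G :=
  [exists k : 'I_t', enters (fun G => S G ++ trace G v' b t') (seqset S) u' a k G].
Let s := t'.-1.

Let lW : local (seqset S) W.
Proof. exact: (local_comp (fun x : bool => x%:R : R) (@local_fresh_meet u v t)). Qed.

Let W0 G : 0 <= W G. Proof. exact: ler0n. Qed.

Let lcatl (S' : D -> seq V) T (X : D -> T) :
  local (seqset S) X -> local (seqset (fun G => S G ++ S' G)) X.
Proof. by move=> h; apply: local_seqset h _ _ => G z zs; rewrite mem_cat zs. Qed.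

Let lcatr (S' : D -> seq V) T (X : D -> T) :
  local (seqset S') X -> local (seqset (fun G => S G ++ S' G)) X.
Proof. by move=> h; apply: local_seqset h _ _ => G z zs; rewrite mem_cat zs orbT. Qed.

Let card_S G : (#|seqset S G| <= t + t)%N.
Proof. by rewrite (leq_trans (card_seqset _ G)) // size_both. Qed.

Let le_e2 v' : local (seqset (fun G => S G ++ trace G v' b t')) (e2 v').
Proof.
move=> G H e; apply: eq_existsb => k.
apply: (local_enters (X := seqset S)) e => //; first exact: local_both.
by apply: local_seqset_self; apply: local_both.
Qed.

Let m1 := (t' * (t + t + t'))%N.

Let sum_e2 : \sum_v' mean (fun G => W G * (e2 v' G)%:R) <= m1%:R * mean W.
Proof.
apply: (mean_enters_before rn _ _ lW W0 card_S); first exact: local_both.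
by apply: local_seqset_self; apply: local_both.
Qed.

Let sum_e3 v' : \sum_u' mean (fun G => W G * (e2 v' G)%:R * (e3 u' v' G)%:R)
  <= m1%:R * mean (fun G => W G * (e2 v' G)%:R).
Proof.
apply: (mean_enters_before rn (W := fun G => W G * (e2 v' G)%:R) _ _ _ _ card_S).
- by apply: local_cat; [apply: local_both | apply: local_trace].
- by apply: lcatl; apply: local_seqset_self; apply: local_both.
- by apply: (local_comp2 (fun x (y : bool) => x * y%:R)); [apply: lcatl | apply: le_e2].
- by move=> G; apply: mulr_ge0.
Qed.

(** The last state of the walk from [v'] before the meeting is new for both pairs, so its step is
    uniform even after revealing the first pair and the walk from [u'] up to time [t']. *)
Let far_right u' v' : mean (fun G => W G * (fresh_meet u' v' t' G && (pos G v' b s \notin S G))%:R)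
  <= n%:R^-1 * mean W.
Proof.
pose B G := S G ++ (trace G u' a t' ++ trace G v' b s).
have lB : local (seqset B) B.
  by apply: local_cat; [apply: local_both | apply: local_cat; apply: local_trace].
have lv T (X : D -> T) : local (seqset (fun G => trace G v' b s)) X -> local (seqset B) X.
  by move=> h; apply: local_seqset h _ _ => G z zs; rewrite !mem_cat zs !orbT.
have lu T (X : D -> T) : local (seqset (fun G => trace G u' a t')) X -> local (seqset B) X.
  by move=> h; apply: local_seqset h _ _ => G z zs; rewrite !mem_cat zs !orbT.
pose ev G := uniq (both u' v' t' G) && (pos G v' b s \notin S G).
have est : s.+1 = t' by rewrite /s prednK.
apply: (@le_trans _ _ (n%:R^-1 * mean (fun G => W G * (ev G)%:R))); last first.
  apply: ler_wpM2l; first by rewrite invr_ge0.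
  by apply: ler_mean => G; rewrite ler_piMr // lern1 leq_b1.
rewrite -[n%:R^-1]mul1r.
rewrite -(@mean_step _ _ _ rn (seqset B) (fun G => W G * (ev G)%:R)
  (fun G => pos G v' b s) (fun G => [set pos G u' a t']) (b s) 1).
- apply: ler_mean => G; rewrite -mulrA -natrM mulnb inE; apply: ler_wpM2l => //.
  rewrite ler_nat /fresh_meet /ev -[in pos G v' b t']est /= [_ == step _ _ _]eq_sym.
  by case: (uniq _); case: (_ == _); case: (_ \notin _).
- exact: local_seqset_self.
- apply: (local_comp2 (fun x (y : bool) => x * y%:R)); first exact: lcatl.
  apply: (local_comp2 andb).
    apply: (local_comp2 (fun x y => uniq (x ++ y))); first by apply: lu; apply: local_trace.
    by rewrite -est; apply: lv; apply: local_traceS.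
  apply: (local_comp2 (fun x (y : seq V) => x \notin y)); last by apply: lcatl; apply: local_both.
  by apply: lv; apply: local_pos.
- by apply: lv; apply: local_pos.
- by apply: (local_comp (fun x => [set x])); apply: lu; apply: local_pos.
- move=> G; rewrite /ev; case: andP => [[h1 h2] _|]; last by rewrite mulr0 eqxx.
  rewrite inE mem_cat negb_or h2 /=.
  by move: h1; rewrite /both -est (traceS G v') -cats1 catA cats1 rcons_uniq => /andP[].
- by move=> G _; rewrite cards1.
Qed.

(** The two walks exchange roles. Keeping the weight [e2] matters: its sum over [v'] is of order
    [m1], whereas without it this case would double the main term. *)
Let far_left u' v' :
  mean (fun G => W G * (e2 v' G)%:R * (fresh_meet u' v' t' G && (pos G u' a s \notin S G))%:R)
  <= n%:R^-1 * mean (fun G => W G * (e2 v' G)%:R).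
Proof.
pose B G := (S G ++ trace G v' b t') ++ trace G u' a s.
have lB1 : local (seqset (fun G => S G ++ trace G v' b t')) (fun G => S G ++ trace G v' b t').
  by apply: local_cat; [apply: local_both | apply: local_trace].
have lB : local (seqset B) B by apply: local_cat => //; apply: local_trace.
have l1 T (X : D -> T) : local (seqset (fun G => S G ++ trace G v' b t')) X -> local (seqset B) X.
  by move=> h; apply: local_seqset h _ _ => G z zs; rewrite mem_cat zs.
have lv T (X : D -> T) : local (seqset (fun G => trace G v' b t')) X -> local (seqset B) X.
  by move=> h; apply: l1; apply: lcatr.
have lu T (X : D -> T) : local (seqset (fun G => trace G u' a s)) X -> local (seqset B) X.
  by move=> h; apply: local_seqset h _ _ => G z zs; rewrite !mem_cat zs !orbT.
pose ev G := uniq (both u' v' t' G) && (pos G u' a s \notin S G).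
have est : s.+1 = t' by rewrite /s prednK.
apply: (@le_trans _ _ (n%:R^-1 * mean (fun G => W G * (e2 v' G)%:R * (ev G)%:R))); last first.
  apply: ler_wpM2l; first by rewrite invr_ge0.
  by apply: ler_mean => G; rewrite ler_piMr ?mulr_ge0 // lern1 leq_b1.
rewrite -[n%:R^-1]mul1r.
rewrite -(@mean_step _ _ _ rn (seqset B) (fun G => W G * (e2 v' G)%:R * (ev G)%:R)
  (fun G => pos G u' a s) (fun G => [set pos G v' b t']) (a s) 1).
- apply: ler_mean => G; rewrite -[X in _ <= X]mulrA -natrM mulnb inE; apply: ler_wpM2l.
    exact: mulr_ge0.
  rewrite ler_nat /fresh_meet /ev -[in pos G u' a t']est /=.
  by case: (uniq _); case: (_ == _); case: (_ \notin _).
- exact: local_seqset_self.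
- apply: (local_comp2 (fun x (y : bool) => x * y%:R)).
    apply: l1; apply: (local_comp2 (fun x (y : bool) => x * y%:R)); first exact: lcatl.
    exact: le_e2.
  apply: (local_comp2 andb).
    apply: (local_comp2 (fun x y => uniq (x ++ y))); last by apply: lv; apply: local_trace.
    by rewrite -est; apply: lu; apply: local_traceS.
  apply: (local_comp2 (fun x (y : seq V) => x \notin y)).
    by apply: lu; apply: local_pos.
  by apply: l1; apply: lcatl; apply: local_both.
- by apply: lu; apply: local_pos.
- by apply: (local_comp (fun x => [set x])); apply: lv; apply: local_pos.
- move=> G; rewrite /ev; case: andP => [[h1 h2] _|]; last by rewrite mulr0 eqxx.
  rewrite inE 2!mem_cat 2!negb_or h2 /=.
  move: h1; rewrite /both -{1}est (traceS G u') uniq_catC -rcons_cat rcons_uniq mem_cat.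
  by case/andP; rewrite negb_or.
- by move=> G _; rewrite cards1.
Qed.

(* Either one walk of the second pair meets the other from a state that is new
   for the first pair, or both have entered the trace of the first pair. *)
Let fresh_meet_split u' v' G : W G * (fresh_meet u' v' t' G)%:R <=
  W G * (fresh_meet u' v' t' G && (pos G v' b s \notin S G))%:R +
  (W G * (e2 v' G)%:R * (fresh_meet u' v' t' G && (pos G u' a s \notin S G))%:R +
   W G * (e2 v' G)%:R * (e3 u' v' G)%:R).
Proof.
rewrite -!mulrA -!mulrDr; apply: ler_wpM2l => //.
rewrite -natrD -natrM -natrD ler_nat.
have [fm|//] := boolP (fresh_meet u' v' t' G).
have [vS|//] := boolP (pos G v' b s \in S G); rewrite /= add0n.
have sl : (s < t')%N by rewrite /s prednK.
move: fm; rewrite /fresh_meet /both cat_uniq => /andP[/and3P[uu nuv uv] _].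
have -> : e2 v' G.
  apply: exists_enters => [z _|]; first by rewrite inE.
  apply/orP; right; apply/hasP; exists (pos G v' b s); first exact: mem_trace.
  by rewrite /= in_set.
rewrite !mul1n; have [uS|//] := boolP (pos G u' a s \in S G).
suff -> : e3 u' v' G by [].
apply: exists_enters => [z zu|].
  rewrite in_set mem_cat => /orP[//|zv]; case/hasP: nuv; by exists z.
apply/orP; right; apply/hasP; exists (pos G u' a s); first exact: mem_trace.
by rewrite /= in_set.
Qed.

(** Summed over [u'] and [v'], [far_right] contributes [n], [far_left] contributes [m1] and the
    double entry [m1 ^+ 2]. Only the first is of leading order, so meetings of two pairs are nearly
    uncorrelated. *)
Lemma sum_second_fresh_meet :
  \sum_u' \sum_v' mean (fun G => (fresh_meet u v t G)%:R * (fresh_meet u' v' t' G)%:R)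
  <= (n%:R + m1%:R + m1%:R ^+ 2) * mean (fun G => (fresh_meet u v t G)%:R) :> R.
Proof.
pose M : R := mean W; pose M2 v' : R := mean (fun G => W G * (e2 v' G)%:R).
apply: (@le_trans _ _ (\sum_u' \sum_v' (n%:R^-1 * M + (n%:R^-1 * M2 v' +
    mean (fun G => W G * (e2 v' G)%:R * (e3 u' v' G)%:R))))).
  apply: ler_sum => u' _; apply: ler_sum => v' _.
  apply: le_trans (lerD (far_right u' v') (lerD (far_left u' v') (lexx _))).
  by rewrite -!meanD; apply: ler_mean => G; apply: fresh_meet_split.
rewrite exchange_big /=.
have nn0 : n%:R != 0 :> R by rewrite pnatr_eq0 -lt0n.
have nK x : \sum_(u' : V) (n%:R^-1 * x) = x :> R.
  by rewrite sumr_const card_ord -[_ *+ n]mulr_natl mulVKf.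
under eq_bigr => v' _ do rewrite !big_split /= !nK.
rewrite !big_split /= sumr_const card_ord -[_ *+ n]mulr_natl !mulrDl -addrA.
apply: lerD => //; apply: lerD; first exact: sum_e2.
apply: (@le_trans _ _ (\sum_v' (m1%:R * M2 v'))); first by apply: ler_sum => v' _; apply: sum_e3.
by rewrite -mulr_sumr expr2 -mulrA; apply: ler_wpM2l => //; apply: sum_e2.
Qed.

End SecondMeeting.

Section MeetCount.
Variables (s T : nat).
Let K := (s + T)%N.

Definition meet_count G : R :=
  \sum_u \sum_v \sum_(i < T) (fresh_meet u v (s + i).+1 G)%:R.

Lemma meet_countE G : meet_count G =
  \sum_(i < T) \sum_u \sum_v (fresh_meet u v (s + i).+1 G)%:R.
Proof.
rewrite [RHS]exchange_big; apply: eq_bigr => u _ /=.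
by rewrite [RHS]exchange_big.
Qed.

Lemma mean_meet_count_ge : T%:R * (n%:R - (3 * K ^ 2)%:R) <= mean meet_count.
Proof.
rewrite (eq_mean meet_countE) mean_sum.
apply: (@le_trans _ _ (\sum_(i < T) (n%:R - (3 * K ^ 2)%:R))).
  by rewrite sumr_const card_ord -[X in _ <= X]mulr_natl.
apply: ler_sum => i _; rewrite mean_sum.
under eq_bigr => u _ do rewrite mean_sum.
apply: le_trans (sum_fresh_meet_ge _) => //.
by rewrite lerD2l lerN2 ler_nat leq_mul2l leq_exp2r //= /K ltn_add2l.
Qed.

Lemma mean_meet_count_sq :
  mean (fun G => meet_count G ^+ 2) <= T%:R ^+ 2 * n%:R * (n%:R + (12 * K ^ 4)%:R).
Proof.
pose F i G : R := \sum_u \sum_v (fresh_meet u v (s + i).+1 G)%:R.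
have -> : mean (fun G => meet_count G ^+ 2)
  = \sum_(i < T) \sum_(j < T) mean (fun G => F i G * F j G).
  under [RHS]eq_bigr => i _ do rewrite -mean_sum.
  rewrite -mean_sum; apply: eq_mean => G.
  rewrite meet_countE expr2 mulr_suml; apply: eq_bigr => i _.
  by rewrite mulr_sumr.
apply: (@le_trans _ _ (\sum_(i < T) \sum_(j < T) (n%:R * (n%:R + (12 * K ^ 4)%:R)))); last first.
  by rewrite !sumr_const card_ord -mulrnA -[_ *+ _]mulr_natl natrM expr2 !mulrA.
apply: ler_sum => i _; apply: ler_sum => j _.
have iK : ((s + i).+1 <= K)%N by rewrite /K ltn_add2l.
have jK : ((s + j).+1 <= K)%N by rewrite /K ltn_add2l.
have -> : mean (fun G => F i G * F j G) = \sum_u \sum_v \sum_u' \sum_v'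
   mean (fun G => (fresh_meet u v (s + i).+1 G)%:R * (fresh_meet u' v' (s + j).+1 G)%:R).
  under [RHS]eq_bigr => u _.
    under eq_bigr => v _.
      under eq_bigr => u' _ do rewrite -mean_sum.
      rewrite -mean_sum; over.
    rewrite -mean_sum; over.
  rewrite -mean_sum; apply: eq_mean => G; rewrite /F mulr_suml; apply: eq_bigr => u _.
  rewrite mulr_suml; apply: eq_bigr => v _.
  rewrite mulr_sumr; apply: eq_bigr => u' _.
  by rewrite mulr_sumr.
set c : R := n%:R + _.
apply: (@le_trans _ _ (\sum_u \sum_v c * mean (fun G => (fresh_meet u v (s + i).+1 G)%:R))).
  apply: ler_sum => u _; apply: ler_sum => v _.
  apply: le_trans (sum_second_fresh_meet _ _ _ _) _ => //.
  apply: ler_wpM2r; first by apply: mean_ge0.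
  rewrite /c -addrA lerD2l -natrX -natrD ler_nat.
  move: iK jK; move: (s + i).+1 (s + j).+1 => x y xK yK.
  have h : (y * (x + x + y) <= 3 * K ^ 2)%N.
    by apply: (@leq_trans (K * (K + K + K))); [apply: leq_mul => //; lia | lia].
  have [K0|K0] := posnP K; first by have -> : (y = 0)%N; lia.
  (* The entry bound is at most [3 * K ^ 2]; it and its square add up to at most [12 * K ^ 4]. *)
  apply: (@leq_trans (3 * K ^ 2 + (3 * K ^ 2) ^ 2)); first by rewrite leq_add // leq_exp2r.
  have : (K ^ 2 <= K ^ 4)%N by rewrite leq_pexp2l.
  by rewrite expnMn -expnM; lia.
under eq_bigr => u _ do rewrite -mulr_sumr.
rewrite -mulr_sumr mulrC; apply: ler_wpM2r; first by rewrite addr_ge0.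
exact: sum_fresh_meet_le.
Qed.

(** Centred at [T n] instead of the mean, so that only the two moment bounds are needed: the terms
    in n^2 cancel, leaving [12 * K ^ 4] from the second moment and [6 * K ^ 2] from the first, each
    times T^2 n. *)
Lemma meet_count_variance : (0 < K)%N ->
  mean (fun G => (meet_count G - T%:R * n%:R) ^+ 2) <= (18 * T ^ 2 * K ^ 4 * n)%:R.
Proof.
move=> K0.
have -> : mean (fun G => (meet_count G - T%:R * n%:R) ^+ 2) =
  mean (fun G => meet_count G ^+ 2) - (2 * T%:R * n%:R) * mean meet_count + (T%:R * n%:R) ^+ 2.
  rewrite -meanZ -meanB -[(T%:R * n%:R) ^+ 2](@mean_cst R D) ?dfa_gt0 // -meanD.
  by apply: eq_mean => G; ring.
have h1 := mean_meet_count_ge; have h2 := mean_meet_count_sq.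
have h3 : (2 * T%:R * n%:R) * (T%:R * (n%:R - (3 * K ^ 2)%:R)) <= (2 * T%:R * n%:R) * mean meet_count.
  by apply: ler_wpM2l => //; rewrite !mulr_ge0.
apply: (le_trans (lerD (lerB h2 h3) (lexx _))).
have : (T ^ 2 * n * K ^ 2)%:R <= (T ^ 2 * n * K ^ 4)%:R :> R.
  by rewrite ler_nat leq_mul2l; apply/orP; right; rewrite leq_pexp2l.
by rewrite !natrM ?natrX; lra.
Qed.

End MeetCount.

End Meetings.

(** * The pair of walks on a fixed DFA *)

Lemma sum_tuple_cons (R : nmodType) (T : finType) k (F : k.+1.-tuple T -> R) :
  \sum_w F w = \sum_x \sum_(w : k.-tuple T) F [tuple of x :: w].
Proof.
rewrite pair_bigA /=; apply: (reindex (fun p : T * k.-tuple T => [tuple of p.1 :: p.2])).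
exists (fun w => (thead w, [tuple of behead w])) => [[x w] _ | w _] /=.
  by congr (_, _); apply: val_inj.
by rewrite [RHS]tuple_eta.
Qed.

Lemma mean_tuple_cons (R : realFieldType) (T : finType) k (F : k.+1.-tuple T -> R) :
  mean F = #|T|%:R^-1 * \sum_x mean (fun w : k.-tuple T => F [tuple of x :: w]).
Proof.
rewrite /mean sum_tuple_cons !card_tuple expnS natrM invfM -mulrA; congr (_ * _).
by rewrite -mulr_sumr.
Qed.

Section Quenched.
Variables (R : realFieldType) (n r : nat).
Hypothesis r0 : (0 < r)%N.
Local Notation V := 'I_n.
Variable G : {ffun V -> letter_map n r}.
Implicit Types (x y z u v w : V) (phi : V -> R) (Phi : V -> V -> R).

Let rr0 : r%:R != 0 :> R. Proof. by rewrite pnatr_eq0 -lt0n. Qed.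
Let ri0 : 0 <= r%:R^-1 :> R. Proof. by rewrite invr_ge0. Qed.

Lemma sum_letters (c : R) : r%:R^-1 * \sum_(i < r) c = c.
Proof. by rewrite sumr_const card_ord -[c *+ r]mulr_natl mulKf. Qed.

Fixpoint ptrans k x z : R :=
  if k is k'.+1 then r%:R^-1 * \sum_c ptrans k' (step G x c) z else (x == z)%:R.

Lemma ptrans_ge0 k x z : 0 <= ptrans k x z.
Proof. by elim: k x => //= k IH x; apply: mulr_ge0 => //; apply: sumr_ge0. Qed.

Lemma sum_ptrans k x : \sum_z ptrans k x z = 1.
Proof.
elim: k x => [|k IH] x /=.
  by rewrite (bigD1 x) //= eqxx big1 ?addr0 // => z; rewrite eq_sym => /negbTE ->.
by rewrite -mulr_sumr exchange_big /= (eq_bigr _ (fun c _ => IH _)) sum_letters.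
Qed.

Lemma ptransD k m x z : ptrans (k + m) x z = \sum_w ptrans k x w * ptrans m w z.
Proof.
elim: k x => [|k IH] x /=.
  rewrite (bigD1 x) //= eqxx mul1r big1 ?addr0 // => w.
  by rewrite eq_sym => /negbTE ->; rewrite mul0r.
rewrite (eq_bigr _ (fun c _ => IH _)) exchange_big /= mulr_sumr.
by apply: eq_bigr => w _; rewrite -mulr_suml mulrA.
Qed.

Lemma ptrans_step k x w c : r%:R^-1 * ptrans k x w <= ptrans k.+1 x (step G w c).
Proof.
rewrite -addn1 ptransD (bigD1 w) //= mulrC.
apply: (@le_trans _ _ (ptrans k x w * (r%:R^-1 * \sum_(d : 'I_r) (step G w d == step G w c)%:R))).
  apply: ler_wpM2l; first exact: ptrans_ge0.
  rewrite ler_peMr // (bigD1 c) //= eqxx lerDl; exact: sumr_ge0.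
rewrite lerDl; apply: sumr_ge0 => z _; apply: mulr_ge0; first exact: ptrans_ge0.
by apply: mulr_ge0 => //; apply: sumr_ge0.
Qed.

(** One minus the total variation distance between the two laws at time [k]. *)
Definition overlap k x y : R := \sum_z Num.min (ptrans k x z) (ptrans k y z).

Lemma overlapD j k x y u v c : 0 <= c -> c <= ptrans j x u -> c <= ptrans j y v ->
  c * overlap k u v <= overlap (j + k) x y.
Proof.
move=> c0 xu yv; rewrite /overlap mulr_sumr; apply: ler_sum => z _.
have h x' u' : c <= ptrans j x' u' -> c * ptrans k u' z <= ptrans (j + k) x' z.
  move=> le_c; rewrite ptransD (bigD1 u') //=.
  apply: (@le_trans _ _ (ptrans j x' u' * ptrans k u' z)).
    by apply: ler_wpM2r => //; apply: ptrans_ge0.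
  by rewrite lerDl; apply: sumr_ge0 => w _; rewrite mulr_ge0 ?ptrans_ge0.
rewrite le_min; apply/andP; split.
  by apply: le_trans (h _ _ xu); apply: ler_wpM2l; rewrite // ge_min lexx.
by apply: le_trans (h _ _ yv); apply: ler_wpM2l; rewrite // ge_min lexx orbT.
Qed.

Definition expect k phi x : R := \sum_z ptrans k x z * phi z.

Lemma expect0 phi x : expect 0 phi x = phi x.
Proof.
rewrite /expect (bigD1 x) //= eqxx mul1r big1 ?addr0 // => z.
by rewrite eq_sym => /negbTE ->; rewrite mul0r.
Qed.

Lemma expectD k m phi x : expect (k + m) phi x = expect k (expect m phi) x.
Proof.
rewrite /expect; under eq_bigr => z _ do rewrite ptransD mulr_suml.
rewrite exchange_big; apply: eq_bigr => w _; rewrite mulr_sumr.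
by apply: eq_bigr => z _; rewrite mulrA.
Qed.

(** Dobrushin's contraction: the common part [m] of the two laws cancels, and both remainders have
    mass [1 - overlap k x y], so their integrals differ by at most this mass times the oscillation
    of [phi]. *)
Lemma expect_contract k kappa : (forall x y, kappa <= overlap k x y) ->
  forall phi omega, (forall x y, phi x - phi y <= omega) ->
  forall x y, expect k phi x - expect k phi y <= (1 - kappa) * omega.
Proof.
move=> hk phi om ho x y; pose m z := Num.min (ptrans k x z) (ptrans k y z).
have om0 : 0 <= om by have := ho x x; rewrite subrr.
pose t := [arg max_(z > x) phi z]%O; pose b := [arg min_(z < x) phi z]%O.
have ht z : phi z <= phi t by rewrite /t; case: arg_maxP => // i _; apply.
have hb z : phi b <= phi z by rewrite /b; case: arg_minP => // i _; apply.
have -> : expect k phi x - expect k phi y =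
  \sum_z (ptrans k x z - m z) * phi z - \sum_z (ptrans k y z - m z) * phi z.
  by rewrite /expect -!sumrB; apply: eq_bigr => z _; ring.
have s1 v : \sum_z (ptrans k v z - m z) = 1 - overlap k x y by rewrite sumrB sum_ptrans.
apply: (@le_trans _ _ ((1 - overlap k x y) * phi t - (1 - overlap k x y) * phi b)).
  apply: lerB; [rewrite -(s1 x) | rewrite -(s1 y)]; rewrite mulr_suml;
    apply: ler_sum => z _; apply: ler_wpM2l => //; rewrite subr_ge0 /m ge_min lexx ?orbT //.
rewrite -mulrBr; apply: (@le_trans _ _ ((1 - overlap k x y) * om)).
  apply: ler_wpM2l => //; rewrite -(s1 x); apply: sumr_ge0 => z _.
  by rewrite subr_ge0 /m ge_min lexx.
by apply: ler_wpM2r => //; rewrite lerD2l lerN2.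
Qed.

Lemma expect_contract_iter k kappa B : (forall x y, kappa <= overlap k x y) ->
  forall phi, (forall x y, phi x - phi y <= 1) ->
  forall x y, expect (B * k) phi x - expect (B * k) phi y <= (1 - kappa) ^+ B.
Proof.
move=> hk phi h1; elim: B => [|B IH] x y; first by rewrite !expect0.
rewrite mulSn !expectD exprS; exact: expect_contract.
Qed.

Lemma expect_bounds k phi x : (forall z, 0 <= phi z <= 1) -> 0 <= expect k phi x <= 1.
Proof.
move=> h; apply/andP; split.
  by apply: sumr_ge0 => z _; rewrite mulr_ge0 ?ptrans_ge0 //; case/andP: (h z).
rewrite -(sum_ptrans k x); apply: ler_sum => z _; rewrite ler_piMr ?ptrans_ge0 //.
by case/andP: (h z).
Qed.

Lemma expectS k phi x : expect k.+1 phi x = r%:R^-1 * \sum_c expect k phi (step G x c).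
Proof.
rewrite /expect exchange_big mulr_sumr; apply: eq_bigr => z _ /=.
by rewrite -mulrA mulr_suml.
Qed.

Lemma expect_avg k (F : 'I_r -> V -> R) x :
  expect k (fun z => r%:R^-1 * \sum_c F c z) x = r%:R^-1 * \sum_c expect k (F c) x.
Proof.
rewrite /expect exchange_big mulr_sumr; apply: eq_bigr => z _ /=.
by rewrite mulrCA mulr_sumr.
Qed.

Definition pair_step Phi x y : R :=
  r%:R^-1 * \sum_c (r%:R^-1 * \sum_d Phi (step G x c) (step G y d)).

Lemma ler_pair_step Phi Psi x y : (forall u v, Phi u v <= Psi u v) ->
  pair_step Phi x y <= pair_step Psi x y.
Proof.
move=> h; apply: ler_wpM2l => //; apply: ler_sum => c _; apply: ler_wpM2l => //.
by apply: ler_sum.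
Qed.

Lemma pair_stepZ a Phi x y : pair_step (fun u v => a * Phi u v) x y = a * pair_step Phi x y.
Proof.
rewrite /pair_step [RHS]mulrCA [a * _]mulr_sumr; congr (_ * _); apply: eq_bigr => c _.
by rewrite [RHS]mulrCA [a * _]mulr_sumr.
Qed.

Definition expect2 k Phi x y : R := expect k (fun z => expect k (Phi z) y) x.

Lemma eq_expect k phi psi x : phi =1 psi -> expect k phi x = expect k psi x.
Proof. by move=> h; apply: eq_bigr => z _; rewrite h. Qed.

Lemma expect2S k Phi x y : expect2 k.+1 Phi x y = pair_step (expect2 k Phi) x y.
Proof.
rewrite /expect2 /pair_step expectS; congr (_ * _); apply: eq_bigr => c _.
by rewrite -expect_avg; apply: eq_expect => z; rewrite expectS.
Qed.

Lemma expect2_exchange k Phi x y :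
  expect2 k Phi x y = expect k (fun w => expect k (Phi^~ w) x) y.
Proof.
rewrite /expect2 /expect; under eq_bigr => z _ do rewrite mulr_sumr.
rewrite exchange_big; apply: eq_bigr => w _ /=; rewrite mulr_sumr.
by apply: eq_bigr => z _; rewrite mulrCA.
Qed.

(** The walks are independent, so one starting state is changed at a time, passing through [(u, y)];
    each change costs one contraction bound. *)
Lemma expect2_contract k kappa B : (forall x y, kappa <= overlap k x y) ->
  forall Phi, (forall x y, 0 <= Phi x y <= 1) -> forall x y u v,
  expect2 (B * k) Phi x y - expect2 (B * k) Phi u v <= 2 * (1 - kappa) ^+ B.
Proof.
move=> hk Phi h x y u v.
have d1 phi : (forall z, 0 <= phi z <= 1) -> forall z w, phi z - phi w <= 1.
  by move=> hphi z w; have := hphi z; have := hphi w; lra.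
have := expect_contract_iter B hk (d1 (fun z => expect (B * k) (Phi z) y) _) x u.
have := expect_contract_iter B hk (d1 (fun w => expect (B * k) (Phi^~ w) u) _) y v.
rewrite -/(expect2 (B * k) Phi x y) -/(expect2 (B * k) Phi u y) -!expect2_exchange.
move=> /(_ (fun z => expect_bounds (B * k) u (h^~ z))) h1.
by move=> /(_ (fun z => expect_bounds (B * k) y (h z))) h2; lra.
Qed.

Fixpoint avoid t x y : R :=
  (x != y)%:R * (if t is t'.+1 then pair_step (avoid t') x y else 1).

Lemma pair_step1 x y : pair_step (fun _ _ => 1) x y = 1.
Proof. by rewrite /pair_step !sum_letters. Qed.

Lemma avoid_bounds t x y : 0 <= avoid t x y <= 1.
Proof.
elim: t x y => [|t IH] x y /=; first by rewrite mulr1 ler0n lern1 leq_b1.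
have h0 : 0 <= pair_step (avoid t) x y.
  apply: mulr_ge0 => //; apply: sumr_ge0 => c _; apply: mulr_ge0 => //.
  by apply: sumr_ge0 => d _; case/andP: (IH (step G x c) (step G y d)).
have h1 : pair_step (avoid t) x y <= 1.
  by rewrite -[X in _ <= X](pair_step1 x y); apply: ler_pair_step => u v; case/andP: (IH u v).
by case: (x != y); rewrite ?mul1r ?mul0r ?h0 ?lexx ?ler01.
Qed.

Lemma avoid_expect2 s t x y : avoid (s + t) x y <= expect2 s (avoid t) x y.
Proof.
elim: s x y => [|s IH] x y; first by rewrite /expect2 !expect0.
rewrite expect2S addSn /=; apply: (@le_trans _ _ (pair_step (avoid (s + t)) x y)).
  rewrite ler_piMl ?lern1 ?leq_b1 //; case/andP: (avoid_bounds (s + t).+1 x y) => /=.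
  by case: (x != y); rewrite ?mul1r ?mul0r // => _ _;
    apply: mulr_ge0 => //; apply: sumr_ge0 => c _; apply: mulr_ge0 => //;
    apply: sumr_ge0 => d _; case/andP: (avoid_bounds (s + t) (step G x c) (step G y d)).
exact: ler_pair_step.
Qed.

Lemma avoidD s t d x y : (forall u v, avoid t u v <= d) ->
  avoid (s + t) x y <= d * avoid s x y.
Proof.
move=> hd; elim: s x y => [|s IH] x y.
  rewrite add0n /= mulr1; have := hd x y; case: t hd => [|t] hd /=;
    by case: (x != y); rewrite ?mul0r ?mulr0 // ?mulr1.
rewrite addSn /= [X in _ <= X]mulrCA; apply: ler_wpM2l => //.
by rewrite -pair_stepZ; apply: ler_pair_step.
Qed.

(* Bernoulli's inequality turns the bound at the multiples of T into a
   geometric one, and at most T steps are lost in between. *)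
Lemma avoid_geometric T theta t x y : (0 < T)%N -> 0 <= theta -> T%:R * theta < 1 ->
  (forall u v, avoid T u v <= 1 - T%:R * theta) ->
  avoid t x y * (1 - T%:R * theta) <= (1 - theta) ^+ t.
Proof.
move=> T0 th0 th1 hT.
have le1 : theta <= T%:R * theta by rewrite ler_peMl // ler1n.
have t01 : 0 <= 1 - theta <= 1 by lra.
have bern k : 1 - k%:R * theta <= (1 - theta) ^+ k.
  elim: k => [|k IH]; first by rewrite mul0r subr0 expr0.
  rewrite exprS; apply: (@le_trans _ _ ((1 - theta) * (1 - k%:R * theta))).
    by rewrite -[k.+1]add1n natrD; have := mulr_ge0 (ler0n R k) (sqr_ge0 theta); rewrite expr2; lra.
  by apply: ler_wpM2l => //; lra.
have per q s : avoid (s + q * T) x y <= (1 - theta) ^+ (q * T).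
  elim: q => [|q IH]; first by rewrite mul0n expr0; case/andP: (avoid_bounds (s + 0) x y).
  have -> : (s + q.+1 * T = (s + q * T) + T)%N by lia.
  apply: le_trans (avoidD _ _ _ hT) _; rewrite mulSn exprD.
  apply: ler_pM => //; first by lra.
  by case/andP: (avoid_bounds (s + q * T) x y).
rewrite {1 2}(divn_eq t T) [X in avoid X]addnC exprD; apply: ler_pM.
- by case/andP: (avoid_bounds (t %% T + t %/ T * T) x y).
- by lra.
- exact: per.
- apply: le_trans (bern _) _; apply: ler_wiXn2l; first by lra.
    by lra.
  by rewrite ltnW // ltn_pmod.
Qed.

Definition nomeet s t x y (a b : nat -> 'I_r) :=
  all (fun i => pos G x a i != pos G y b i) (iota s t.+1).

Lemma pos_cons (c0 c : 'I_r) (p : seq 'I_r) x i :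
  pos G x (nth c0 (c :: p)) i.+1 = pos G (step G x c) (nth c0 p) i.
Proof. by elim: i => //= i ->. Qed.

Lemma nomeet_cons (c0 : 'I_r) s t x y c (p : seq 'I_r) d (q : seq 'I_r) :
  nomeet s.+1 t x y (nth c0 (c :: p)) (nth c0 (d :: q)) =
  nomeet s t (step G x c) (step G y d) (nth c0 p) (nth c0 q).
Proof.
rewrite /nomeet -[s.+1]add1n iotaDl all_map; apply: eq_all => i.
by rewrite /preim /= -!pos_cons.
Qed.

(** Links the walk on a fixed DFA to walks driven by uniform words: the first [s] letters carry the
    burn-in and the remaining [t] the search for a meeting. The default [c0] is never read at times
    up to [s + t]. *)
Lemma mean_words (c0 : 'I_r) s t x y :
  mean (fun a : (s + t).-tuple 'I_r => mean (fun b : (s + t).-tuple 'I_r =>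
     (nomeet s t x y (nth c0 a) (nth c0 b))%:R)) = expect2 s (avoid t) x y.
Proof.
have cons k (F : (nat -> 'I_r) -> (nat -> 'I_r) -> R) :
  mean (fun a : k.+1.-tuple 'I_r => mean (fun b : k.+1.-tuple 'I_r =>
     F (nth c0 a) (nth c0 b)))
  = r%:R^-1 * \sum_c r%:R^-1 * \sum_d
     mean (fun a : k.-tuple 'I_r => mean (fun b : k.-tuple 'I_r =>
       F (nth c0 (c :: a)) (nth c0 (d :: b)))).
  rewrite mean_tuple_cons card_ord; congr (_ * _); apply: eq_bigr => c _.
  rewrite -mean_sum -meanZ; apply: eq_mean => a.
  by rewrite mean_tuple_cons card_ord.
elim: s x y => [|s IH] x y; last first.
  rewrite expect2S addSn (cons (s + t)%N (fun a b => (nomeet s.+1 t x y a b)%:R)).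
  congr (_ * _); apply: eq_bigr => c _; congr (_ * _); apply: eq_bigr => d _.
  rewrite -IH; apply: eq_mean => a; apply: eq_mean => b.
  by rewrite nomeet_cons.
rewrite add0n /expect2 !expect0; elim: t x y => [|t IH] x y.
  have -> : avoid 0 x y = (x != y)%:R by rewrite /= mulr1.
  rewrite -[RHS](@mean_cst R (0.-tuple 'I_r)) ?card_tuple //; apply: eq_mean => a.
  rewrite -[RHS](@mean_cst R (0.-tuple 'I_r)) ?card_tuple //; apply: eq_mean => b.
  by rewrite /nomeet /= andbT.
rewrite (cons t (fun a b => (nomeet 0 t.+1 x y a b)%:R)) /= /pair_step.
rewrite [RHS]mulrCA [(x != y)%:R * _]mulr_sumr; congr (_ * _); apply: eq_bigr => c _.
rewrite [RHS]mulrCA [(x != y)%:R * _]mulr_sumr; congr (_ * _); apply: eq_bigr => d _.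
rewrite -IH -meanZ; apply: eq_mean => a; rewrite -meanZ; apply: eq_mean => b.
rewrite -(nomeet_cons c0 0 t x y c a d b) /nomeet -natrM mulnb.
by [].
Qed.

(** A meeting puts the common state into both traces at every later time, so no later meeting is
    fresh. A fresh meeting also contradicts [nomeet], so at most one term equals 1. *)
Lemma nomeet_meet_count s t (u v : V) (a b : nat -> 'I_r) :
  (nomeet s t u v a b)%:R + \sum_(i < t) (fresh_meet a b u v (s + i).+1 G)%:R <= 1 :> R.
Proof.
have excl i j : (i < j)%N -> fresh_meet a b u v i G -> ~~ fresh_meet a b u v j G.
  move=> ij /andP[_ /eqP e]; rewrite negb_and; apply/orP; left.
  rewrite /both cat_uniq !negb_and negbK; apply/orP; right; apply/orP; left.
  by apply/hasP; exists (pos G v b i); rewrite ?mem_trace //= -e mem_trace.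
have [i fi|no] := pickP (fun i : 'I_t => fresh_meet a b u v (s + i).+1 G); last first.
  by rewrite big1 ?addr0 ?lern1 ?leq_b1 // => i _; rewrite no.
rewrite (bigD1 i) //= fi big1 ?addr0; last first.
  move=> j ji; have [ltij|ltji|/val_inj eij] := ltngtP i j.
  - by rewrite (negbTE (excl _ _ _ fi)) // ltnS ltn_add2l.
  - by case: (boolP (fresh_meet _ _ _ _ (s + j).+1 _)) => // fj;
      have := excl (s + j).+1 (s + i).+1 _ fj; rewrite fi ltnS ltn_add2l => /(_ ltji).
  - by rewrite eij eqxx in ji.
suff -> : nomeet s t u v a b = false by rewrite add0r.
apply/negbTE/allPn; exists (s + i).+1.
  by rewrite mem_iota; have := ltn_ord i; lia.
by rewrite negbK; case/andP: fi.
Qed.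

Lemma sum_expect2_meet_count (c0 : 'I_r) s t :
  \sum_u \sum_v expect2 s (avoid t) u v <= (n * n)%:R -
  mean (fun a : (s + t).-tuple 'I_r => mean (fun b : (s + t).-tuple 'I_r =>
     meet_count R (nth c0 a) (nth c0 b) s t G)).
Proof.
have w0 : (0 < #|{: (s + t).-tuple 'I_r}|)%N by rewrite card_tuple card_ord expn_gt0 r0.
have -> : (n * n)%:R = mean (fun a : (s + t).-tuple 'I_r =>
    mean (fun b : (s + t).-tuple 'I_r => \sum_(u : V) \sum_(v : V) 1)) :> R.
  by rewrite !mean_cst // !sumr_const card_ord -mulrnA.
rewrite -meanB; under [X in _ <= X]eq_mean => a do rewrite -meanB.
under eq_bigr => u _ do under eq_bigr => v _ do rewrite -(mean_words c0).
under eq_bigr => u _ do rewrite -mean_sum.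
rewrite -mean_sum; apply: ler_mean => a.
under eq_bigr => u _ do rewrite -mean_sum.
rewrite -mean_sum; apply: ler_mean => b.
rewrite /meet_count -sumrB; apply: ler_sum => u _.
rewrite -sumrB; apply: ler_sum => v _.
by rewrite lerBrDr; apply: nomeet_meet_count.
Qed.

End Quenched.

(** * The tail over trajectories as a first-step recursion *)

Section MeetTail.
Variables (R : realType) (n r : nat).
Hypothesis r0 : (0 < r)%N.
Local Notation V := 'I_n.
Variable G : {ffun V -> letter_map n r}.

Lemma sum_walk_mx x (phi : V -> R) :
  \sum_y walk_mx R G x y * phi y = r%:R^-1 * \sum_c phi (step G x c).
Proof.
under eq_bigr => y _ do rewrite mxE -mulrA mulr_suml.
rewrite -mulr_sumr exchange_big; congr (_ * _); apply: eq_bigr => c _ /=.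
rewrite (bigD1 (step G x c)) //= eqxx mul1r big1 ?addr0 // => y.
by rewrite eq_sym => /negbTE; rewrite /step => ->; rewrite mul0r.
Qed.

Lemma meet_timeE t (w : t.+1.-tuple (V * V)) :
  (t < meet_time w)%N = all (fun z => z.1 != z.2) w.
Proof.
rewrite -[RHS]negbK -has_predC has_find size_tuple -leqNgt.
by rewrite /meet_time (eq_find (a2 := predC (fun z : V * V => z.1 != z.2))) // => z /=; rewrite negbK.
Qed.


Lemma path_law_cons (S : finType) (Q : S -> S -> R) z t z0 (w : t.+1.-tuple S) :
  path_law Q z [tuple of z0 :: w] = (z0 == z)%:R * (Q z0 (thead w) * \prod_(s < t)
     Q (tnth w (widen_ord (leqnSn t) s)) (tnth w (lift ord0 s))).
Proof.
rewrite /path_law theadE big_ord_recl; congr (_ * (_ * _)).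
  by congr (Q _ _); rewrite (tnth_nth z0) //= /thead (tnth_nth z0).
by apply: eq_bigr => s _; congr (Q _ _); rewrite !(tnth_nth z0).
Qed.

Lemma meet_tailE t x y : meet_tail R G x y t = avoid R G t x y.
Proof.
rewrite /meet_tail; under eq_bigl => w do rewrite meet_timeE.
elim: t x y => [|t IH] x y; rewrite big_mkcond sum_tuple_cons /=.
  rewrite (bigD1 (x, y)) //= [X in _ + X]big1 => [|z zxy]; last first.
    rewrite big1 // => w _; case: ifP => // _.
    by rewrite /path_law theadE (negbTE zxy) mul0r.
  rewrite addr0 (big_pred1 [tuple]) => [|w]; last by apply/esym/eqP; apply: tuple0.
  by rewrite /= /path_law theadE eqxx big_ord0 andbT; case: (x != y); rewrite ?mulr1 ?mul1r.
rewrite (bigD1 (x, y)) //= [X in _ + X]big1 => [|z zxy]; last first.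
  rewrite big1 // => w _; case: ifP => // _.
  by rewrite path_law_cons (negbTE zxy) mul0r.
rewrite addr0; case: (x != y) => /=; last by rewrite big1 ?mul0r.
rewrite mul1r -big_mkcond /=.
(* Condition on the second state. The rest of the trajectory is summed over all possible initial
   states, of which only [thead w] contributes. *)
transitivity (\sum_x' walk_mx R G x x' * \sum_y' walk_mx R G y y' * avoid R G t x' y').
  under [RHS]eq_bigr => x' _ do rewrite mulr_sumr.
  rewrite pair_bigA /=.
  under [RHS]eq_bigr => z _ do rewrite -IH mulrA mulr_sumr.
  rewrite exchange_big /=; apply: eq_bigr => w _.
  rewrite path_law_cons eqxx mul1r.
  rewrite (bigD1 (thead w)) //= [X in _ + X]big1 => [|z zw]; last first.
    by rewrite /path_law -surjective_pairing eq_sym (negbTE zw) mul0r mulr0.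
  by rewrite addr0 /path_law -surjective_pairing eqxx mul1r.
rewrite sum_walk_mx /pair_step; congr (_ * _); apply: eq_bigr => c _.
by rewrite sum_walk_mx.
Qed.

End MeetTail.

(** * Sets of successors in a random DFA *)

(** Lets a union bound over sets with at most [k] elements run over [k]-tuples, whose number is a
    plain power. *)
Lemma cover_tuple (T : finType) (x0 : T) (B : {set T}) k : (#|B| <= k)%N ->
  exists t : k.-tuple T, B \subset [set x in t].
Proof.
move=> Bk; have h : size (enum B ++ nseq (k - #|B|) x0) == k.
  by rewrite size_cat size_nseq -cardE subnKC.
exists (Tuple h); apply/subsetP => x xB; rewrite inE memtE /= mem_cat mem_enum.
by rewrite xB.
Qed.

Lemma card_set_tuple (T : finType) k (t : k.-tuple T) : (#|[set x in t]| <= k)%N.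
Proof. by rewrite cardsE (leq_trans (card_size _)) // size_tuple. Qed.

Section Neighbours.
Variables (R : realFieldType) (n r : nat).
Hypotheses (rn : (r <= n)%N).
Local Notation V := 'I_n.
Local Notation L := (letter_map n r).
Local Notation D := {ffun V -> L}.
Implicit Types (G : D) (A B F X M Q : {set V}) (u v w z : V).

Definition nbs G A : {set V} := \bigcup_(z in A) succs (G z).

Lemma nbsP G A w : reflect (exists z c, z \in A /\ w = step G z c) (w \in nbs G A).
Proof.
apply: (iffP bigcupP) => [[z zA /imsetP[c _ ->]]|[z [c [zA ->]]]].
  by exists z, c.
by exists z => //; apply: imset_f.
Qed.

Lemma nbsS G A B : A \subset B -> nbs G A \subset nbs G B.
Proof.
move=> /subsetP AB; apply/subsetP => w /nbsP[z [c [zA ->]]]; apply/nbsP.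
by exists z, c; split=> //; apply: AB.
Qed.

Lemma nbsU G A B : nbs G (A :|: B) = nbs G A :|: nbs G B.
Proof.
apply/setP => w; rewrite inE; apply/nbsP/orP => [[z [c []]]|].
  by rewrite inE => /orP[zA|zB] ->; [left|right]; apply/nbsP; exists z, c.
by case=> /nbsP[z [c [zA ->]]]; exists z, c; rewrite inE zA ?orbT.
Qed.

Lemma card_nbs G A : (#|nbs G A| <= r * #|A|)%N.
Proof.
apply: (@leq_trans (\sum_(z in A) #|succs (G z)|)).
  rewrite /nbs; elim/big_ind2: _ => [|X1 n1 X2 n2 h1 h2|//]; first by rewrite cards0.
  by apply: leq_trans (leq_card_setU _ _) _; apply: leq_add.
by rewrite (eq_bigr (fun=> r)) ?sum_nat_const 1?mulnC // => z _; apply: card_succs.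
Qed.

Lemma agree_nbs G H A : agree A G H -> nbs H A = nbs G A.
Proof. by move=> e; apply: eq_bigr => z zA; rewrite e. Qed.

Lemma mean_all (F : {set V}) (P : V -> pred L) (q : R) :
  (forall z, z \in F -> mean (fun l => (P z l)%:R) <= q) ->
  mean (fun G : D => [forall (z | z \in F), P z (G z)]%:R) <= q ^+ #|F|.
Proof.
move=> h; have -> : mean (fun G : D => [forall (z | z \in F), P z (G z)]%:R) =
    \prod_(z in F) mean (fun l => (P z l)%:R : R).
  rewrite -mean_prod_set ?letter_map_gt0 //; apply: eq_mean => G.
  have [/forall_inP allP|] := boolP [forall (z | z \in F), P z (G z)]; first by rewrite big1 // => z /allP ->.
  rewrite negb_forall => /existsP[z]; rewrite negb_imply => /andP[zF /negbTE nP].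
  by rewrite (bigD1 z) //= nP mul0r.
rewrite -prodr_const; apply: ler_prod => z zF; rewrite h // andbT.
by apply: mean_ge0 => l; apply: ler0n.
Qed.

Lemma mean_nbs_sub A B :
  mean (fun G => (nbs G A \subset B)%:R) <= (#|B|%:R / n%:R) ^+ (r * #|A|) :> R.
Proof.
rewrite exprM; apply: le_trans (mean_all (P := fun _ l => succs l \subset B) _) => [|z _].
  apply: ler_mean => G; rewrite ler_nat; case: (boolP (_ \subset _)) => // sub.
  rewrite lt0b; apply/forall_inP => z zA; apply: subset_trans sub.
  exact: (bigcup_sup z).
exact: mean_succs_sub.
Qed.

(* The M chosen here is a largest subset of F with disjoint sets of
   successors outside X; every other vertex of F then has a successor in X or
   in nbs M. *)
Lemma exists_growth G F X : exists2 Q : {set V}, Q \subset F &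
  (r * #|F :\: Q| <= #|nbs G F :\: X|)%N /\
  [forall (z | z \in Q), ~~ [disjoint succs (G z) & X :|: nbs G (F :\: Q)]].
Proof.
pose P M := [&& M \subset F, [disjoint nbs G M & X] & #|nbs G M| == (r * #|M|)%N].
have nbs0 : nbs G set0 = set0 by rewrite /nbs big_set0.
have P0 : P set0 by rewrite /P sub0set nbs0 -setI_eq0 set0I cards0 muln0 !eqxx.
have [M /and3P[MF dM /eqP cM] maxM] : exists2 M : {set V}, P M & forall N : {set V}, P N -> (#|N| <= #|M|)%N.
  pose M := [arg max_(M > set0 | P M) #|M|].
  by exists M; rewrite /M; case: arg_maxnP.
exists (F :\: M); first exact: subsetDl.
have -> : F :\: (F :\: M) = M by rewrite setDDr setDv set0U; apply/setIidPr.
split.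
  rewrite -cM; apply: subset_leq_card; rewrite subsetD dM andbT.
  exact: nbsS.
apply/forall_inP => z; rewrite inE => /andP[zM zF]; apply/negP => dz.
have : P (z |: M).
  have nbz : nbs G [set z] = succs (G z) by rewrite /nbs big_set1.
  rewrite /P subUset sub1set zF MF /= nbsU nbz.
  move: dz dM; rewrite -!setI_eq0 setIUr setU_eq0 => /andP[zX zNM] MX.
  rewrite setIUl setU_eq0 zX MX /= cardsU (eqP zNM) cards0 subn0 card_succs cM.
  by rewrite cardsU1 zM mulnDr muln1.
by move/maxM; rewrite cardsU1 zM ltnn.
Qed.

(* Union bound over the set Q of vertices of F without fresh successors, with
   the values of G off Q held fixed. *)
Lemma mean_growth F X e k (q : R) : (0 < e)%N -> (e * k <= #|F|)%N ->
  0 <= q <= 1 ->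
  r%:R * (#|X| + r * #|F|)%:R / n%:R * 2 ^+ e <= q ->
  mean (fun G => (e * #|nbs G F :\: X| < e.-1 * (r * #|F|))%:R) <= q ^+ k :> R.
Proof.
move=> e0 kF /andP[q0 q1] hq.
pose y : R := r%:R * (#|X| + r * #|F|)%:R / n%:R.
have y0 : 0 <= y by rewrite /y !mulr_ge0 ?invr_ge0.
pose E Q G := [forall (z | z \in Q), ~~ [disjoint succs (G z) & X :|: nbs G (F :\: Q)]].
have EQ Q : mean (fun G => (E Q G)%:R) <= y ^+ #|Q|.
  rewrite (eq_mean (psi := fun G => 1 * (E Q G)%:R)) => [|G]; last by rewrite mul1r.
  apply: le_trans (_ : _ <= y ^+ #|Q| * mean (fun _ : D => 1)) _; last by rewrite mean1 ?mulr1.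
  apply: (@mean_resample_le _ _ _ (fun=> ~: Q) (fun=> 1) (fun G => (E Q G)%:R)) => // G _.
  pose X' := X :|: nbs G (F :\: Q).
  apply: le_trans (mean_all (P := fun _ l => ~~ [disjoint succs l & X']) _) => [|z _].
    apply: ler_mean => H; rewrite ler_nat leq_eqVlt; apply/orP; left; apply/eqP; congr nat_of_bool.
    rewrite /E (agree_nbs (G := G)) => [|z]; last by rewrite !inE ffunE !inE => /andP[/negbTE ->].
    by apply: eq_forallb_in => z zQ; rewrite ffunE inE zQ.
  apply: le_trans (mean_succs_meet _ rn _) _; rewrite /y -!mulrA; apply: ler_wpM2l => //.
  apply: ler_wpM2r; rewrite ?invr_ge0 // ler_nat (leq_trans (leq_card_setU _ _)) // leq_add2l.
  apply: leq_trans (card_nbs _ _) _; rewrite leq_mul2l subset_leq_card ?orbT //.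
  exact: subsetDl.
apply: (@le_trans _ _ (\sum_(Q : {set V} | (Q \subset F) && (#|F| < e * #|Q|)%N) mean (fun G => (E Q G)%:R))).
  rewrite -mean_sum; apply: ler_mean => G; case: ltnP => [lt|_]; last by apply: sumr_ge0.
  have [Q QF [hQ EG]] := exists_growth G F X.
  have cF : (#|F :\: Q| = #|F| - #|Q|)%N by rewrite cardsD; congr (_ - #|pred_of_set _|)%N; apply/setIidPr.
  have QleF := subset_leq_card QF.
  (* Otherwise [F :\: Q] would keep at least the fraction (e - 1)/e of [F], and its [r] fresh
     successors per state would contradict the assumed shortage. *)
  have Qe : (#|F| < e * #|Q|)%N.
    have : (r * (e * #|F :\: Q|) < r * (e.-1 * #|F|))%N.
      by rewrite mulnCA (leq_ltn_trans _ (leq_trans lt _)) ?leq_mul2l ?hQ ?orbT // mulnCA.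
    rewrite ltn_mul2l cF => /andP[_]; rewrite mulnBr -subn1 mulnBl mul1n.
    by have := leq_mul (leqnn e) QleF; have := leq_pmull #|F| e0; lia.
  rewrite (bigD1 Q) /= ?QF ?Qe // /E EG lerDl; exact: sumr_ge0.
(* Each state of [Q] brings a factor [2^-1 ^+ e * q]. As [e * #|Q|] exceeds [#|F|], the powers of
   1/2 pay for all subsets of [F], and at least [k] factors [q] remain. *)
have term Q : (Q \subset F) && (#|F| < e * #|Q|)%N -> mean (fun G => (E Q G)%:R) <= 2^-1 ^+ #|F| * q ^+ k.
  move=> /andP[_ Qe]; apply: le_trans (EQ Q) _.
  have yq : y <= 2^-1 ^+ e * q.
    by rewrite exprVn mulrC ler_pdivlMr ?exprn_gt0.
  apply: le_trans (_ : _ <= (2^-1 ^+ e * q) ^+ #|Q|) _; first by apply: lerXn2r; rewrite ?nnegrE ?(le_trans y0).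
  rewrite exprMn -exprM; apply: ler_pM; rewrite ?exprn_ge0 ?invr_ge0 //.
    by apply: ler_wiXn2l; rewrite ?invr_ge0 ?invf_le1 ?ler1n // ltnW.
  apply: ler_wiXn2l => //; rewrite -(leq_pmul2l e0) (leq_trans kF) //; exact: ltnW.
apply: le_trans (ler_sum _ term) _.
rewrite sumr_const -[_ *+ _]mulr_natl mulrA ler_piMl ?exprn_ge0 //.
rewrite exprVn ler_pdivrMr ?exprn_gt0 // mul1r -natrX ler_nat -card_powerset.
apply: subset_leq_card; apply/subsetP => Q; rewrite powersetE unfold_in => /andP[].
by [].
Qed.

(** With fewer than [m] hits, some [m]-tuple covers them all, and the letter [c] then sends every
    state of [F] outside the uncovered part of [I]. The power of [n] counts the tuples. *)
Lemma mean_hits F I m (c : 'I_r) : (0 < n)%N ->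
  mean (fun G => (#|nbs G F :&: I| < m)%:R)
    <= n%:R ^+ m * (1 - (#|I| - m)%:R / n%:R) ^+ #|F| :> R.
Proof.
move=> n0; pose E (t : m.-tuple V) G :=
  [forall (z | z \in F), val (G z) c \notin I :\: [set x in t]].
apply: (@le_trans _ _ (\sum_t mean (fun G => (E t G)%:R))).
  rewrite -mean_sum; apply: ler_mean => G; case: ltnP => [lt|_]; last by apply: sumr_ge0.
  have [t tS] := cover_tuple (Ordinal n0) (ltnW lt).
  rewrite (bigD1 t) //=; suff -> : E t G by rewrite lerDl; apply: sumr_ge0.
  apply/forall_inP => z zF; rewrite inE negb_and negbK.
  have [zI|] := boolP (val (G z) c \in I); rewrite ?orbT // orbF.
  apply: (subsetP tS); rewrite inE zI andbT; apply/nbsP; by exists z, c.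
apply: (@le_trans _ _ (\sum_(t : m.-tuple V) (1 - (#|I| - m)%:R / n%:R) ^+ #|F|)); last first.
  by rewrite sumr_const card_tuple card_ord -[_ *+ _]mulr_natl natrX.
apply: ler_sum => t _.
apply: (mean_all (P := fun _ (l : L) => val l c \notin I :\: [set x in t])) => z _.
have -> : mean (fun l : L => (val l c \notin I :\: [set x in t])%:R)
   = 1 - #|I :\: [set x in t]|%:R / n%:R :> R.
  rewrite -(mean_letter R rn c) -[X in X - _](@mean_cst R L) ?letter_map_gt0 // -meanB.
  by apply: eq_mean => l; case: (_ \in _); rewrite ?subr0 ?subrr.
rewrite lerD2l lerN2; apply: ler_wpM2r; rewrite ?invr_ge0 // ler_nat cardsD.
by apply: leq_sub2l; apply: leq_trans (card_set_tuple t); apply: subset_leq_card; apply: subsetIr.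
Qed.

(** Union bound over [w] and over its possible sets of [l] predecessors; each predecessor has
    probability at most r/n, and binomial(n, l) <= n^l / l!. *)
Lemma mean_indegree l : (0 < n)%N ->
  mean (fun G => [exists w, (l <= #|[set z | w \in succs (G z)]|)%N]%:R)
    <= n%:R * r%:R ^+ l / l`!%:R :> R.
Proof.
move=> n0; have nn0 : n%:R != 0 :> R by rewrite pnatr_eq0 -lt0n.
pose E w (Q : {set V}) G := [forall (z | z \in Q), w \in succs (G z)].
apply: (@le_trans _ _ (\sum_w \sum_(Q : {set V} | #|Q| == l) mean (fun G => (E w Q G)%:R))).
  under eq_bigr => w _ do rewrite -mean_sum.
  rewrite -mean_sum; apply: ler_mean => G; case: existsP => [[w]|_]; last first.
    by apply: sumr_ge0 => w _; apply: sumr_ge0.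
  move=> /card_geqP[s [us ss sub]].
  rewrite (bigD1 w) //= (bigD1 [set z in s]) /=; last by rewrite cardsE -ss; apply/eqP/card_uniqP.
  suff -> : E w [set z in s] G.
    by rewrite -addrA lerDl addr_ge0 // sumr_ge0 // => x _; apply: sumr_ge0.
  by apply/forall_inP => z; rewrite inE => /sub; rewrite inE.
apply: (@le_trans _ _ (\sum_(w : V) \sum_(Q : {set V} | #|Q| == l) (r%:R / n%:R) ^+ l)).
  apply: ler_sum => w _; apply: ler_sum => Q /eqP <-.
  apply: (mean_all (P := fun _ x => w \in succs x)) => z _.
  apply: le_trans (_ : _ <= r%:R * #|[set w]|%:R / n%:R) _; last by rewrite cards1 mulr1.
  apply: le_trans (mean_succs_meet R rn [set w]); apply: ler_mean => x.
  by rewrite disjoint_sym disjoints1 negbK.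
rewrite sumr_const card_ord -[X in X <= _]mulr_natl -mulrA; apply: ler_wpM2l => //.
rewrite sumr_const -cardsE card_draws card_ord -[X in X <= _]mulr_natl expr_div_n.
rewrite ler_pdivlMr ?ltr0n ?fact_gt0 // mulrAC -natrM bin_ffact mulrA ler_pdivrMr ?exprn_gt0 ?ltr0n //.
rewrite mulrC; apply: ler_wpM2l; first by apply: exprn_ge0.
rewrite -natrX ler_nat; elim: (l) => [|k IH]; first by rewrite ffactn0.
by rewrite ffactnSr expnSr leq_mul ?leq_subr.
Qed.

(** If [A] grows too little, then [A] and its [r * #|A|] edges fall into some set of c = r #|A| - 1
    states. The at most n^c such sets meet a probability of order n^-(c + 1), which leaves a single
    factor 1/n. *)
Lemma mean_small_growth K : (0 < n)%N -> (0 < r)%N ->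
  mean (fun G => [exists A : {set V}, (0 < #|A| <= K)%N && (#|A :|: nbs G A| < r * #|A|)%N]%:R)
    <= (K * (2 * (r * K)) ^ (r * K))%:R / n%:R :> R.
Proof.
move=> n0 r0; have nn0 : n%:R != 0 :> R by rewrite pnatr_eq0 -lt0n.
pose c m := (r * m.+1).-1.
pose E m (t : (c m).-tuple V) (A : {set V}) G := nbs G A \subset [set x in t].
pose P m (t : (c m).-tuple V) (A : {set V}) := (A \subset [set x in t]) && (#|A| == m.+1).
apply: (@le_trans _ _ (\sum_(m < K) \sum_(t : (c m).-tuple V)
     \sum_(A : {set V} | P m t A) mean (fun G => (E m t A G)%:R))).
  under eq_bigr => m _.
    under eq_bigr => t _ do rewrite -mean_sum.
    rewrite -mean_sum; over.
  rewrite -mean_sum; apply: ler_mean => G; case: existsP => [[A]|_]; last first.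
    by apply: sumr_ge0 => m _; apply: sumr_ge0 => t _; apply: sumr_ge0.
  move=> /andP[/andP[A0 AK] lt].
  have mK : (#|A|.-1 < K)%N by rewrite prednK.
  have h : (#|A :|: nbs G A| <= c #|A|.-1)%N by rewrite /c prednK //; lia.
  have [t tS] := cover_tuple (Ordinal n0) h.
  rewrite (bigD1 (Ordinal mK)) //= (bigD1 t) //= (bigD1 A) /=; last first.
    by rewrite /P prednK // eqxx andbT; apply: subset_trans tS; apply: subsetUl.
  have -> : E (Ordinal mK) t A G by apply: subset_trans tS; apply: subsetUr.
  rewrite -!addrA lerDl !addr_ge0 // sumr_ge0 // => x _; do ?apply: sumr_ge0 => *; by do ?apply: sumr_ge0.
apply: (@le_trans _ _ (\sum_(m < K) ((2 * (r * K)) ^ (r * K))%:R / n%:R)); last first.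
  by rewrite sumr_const card_ord -[X in X <= _]mulr_natl natrM mulrA.
apply: ler_sum => m _.
have mK := ltn_ord m.
have cE : (r * m.+1 = (c m).+1)%N by rewrite /c prednK // muln_gt0 r0.
have cK : ((c m).+1 <= r * K)%N by rewrite -cE leq_mul2l mK orbT.
pose x : R := (c m)%:R / n%:R.
apply: (@le_trans _ _ (\sum_(t : (c m).-tuple V) (2 ^ c m)%:R * x ^+ (c m).+1)).
  apply: ler_sum => t _.
  apply: (@le_trans _ _ (\sum_(A : {set V} | P m t A) x ^+ (c m).+1)).
    apply: ler_sum => A /andP[At /eqP cA]; apply: le_trans (mean_nbs_sub _ _) _.
    rewrite cA cE; apply: lerXn2r; rewrite ?nnegrE ?divr_ge0 //.
    by apply: ler_wpM2r; rewrite ?invr_ge0 // ler_nat card_set_tuple.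
  rewrite sumr_const -[X in X <= _]mulr_natl; apply: ler_wpM2r; first by rewrite exprn_ge0 // divr_ge0.
  rewrite ler_nat (leq_trans (n := #|powerset [set x in t]|)) //.
    by apply: subset_leq_card; apply/subsetP => A; rewrite powersetE unfold_in => /andP[].
  by rewrite card_powerset leq_exp2l // card_set_tuple.
rewrite sumr_const card_tuple card_ord -[X in X <= _]mulr_natl.
have -> : (n ^ c m)%:R * ((2 ^ c m)%:R * x ^+ (c m).+1) =
    (2 ^ c m * c m ^ (c m).+1)%:R / n%:R.
  rewrite /x expr_div_n !natrM !natrX [n%:R ^+ (c m).+1]exprS.
  by field; rewrite nn0 expf_neq0.
apply: ler_wpM2r; rewrite ?invr_ge0 // ler_nat.
have rK : (0 < 2 * (r * K))%N by rewrite muln_gt0 (leq_trans _ cK).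
apply: leq_trans (leq_pexp2l rK cK); rewrite expnMn leq_mul ?leq_exp2l ?leq_exp2r //.
exact: ltnW.
Qed.

End Neighbours.

(** * Exploration from two states *)

(* A plain inequality, usable by lia, unlike the leqif of leq_card_setU. *)
Lemma leq_cardU (T : finType) (A B : {set T}) : (#|A :|: B| <= #|A| + #|B|)%N.
Proof. exact: leq_card_setU. Qed.

Section Exploration.
Variables (R : realFieldType) (n r : nat).
Hypotheses (rn : (r <= n)%N) (r2 : (2 <= r)%N).
Local Notation V := 'I_n.
Local Notation L := (letter_map n r).
Local Notation D := {ffun V -> L}.
Implicit Types (G : D) (A B F X M Q : {set V}) (u v w z : V).

Let r0 : (0 < r)%N. Proof. exact: ltnW. Qed.

(** Conditional form of [mean_growth]: the front is disjoint from the revealed set, so given the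
    latter its maps are still independent and uniform. *)
Lemma mean_growth_local (S F X : D -> {set V}) e k m (q : R) :
  local S S -> local S F -> local S X -> (forall G, [disjoint F G & S G]) ->
  (forall G, #|X G| + r * #|F G| <= m)%N -> (0 < e)%N -> 0 <= q <= 1 ->
  r%:R * m%:R / n%:R * 2 ^+ e <= q ->
  mean (fun G => ((e * k <= #|F G|) && (e * #|nbs G (F G) :\: X G| < e.-1 * (r * #|F G|)))%N%:R)
    <= q ^+ k.
Proof.
move=> lS lF lX dFS hm e0 q01 hq.
have -> : mean (fun G => ((e * k <= #|F G|) && (e * #|nbs G (F G) :\: X G| < e.-1 * (r * #|F G|)))%N%:R)
   = mean (fun G => (e * k <= #|F G|)%N%:R * (e * #|nbs G (F G) :\: X G| < e.-1 * (r * #|F G|))%N%:R) :> R.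
  by apply: eq_mean => G; rewrite -natrM mulnb.
apply: (@le_trans _ _ (q ^+ k * mean (fun G => (e * k <= #|F G|)%N%:R))); last first.
  rewrite ler_piMr ?exprn_ge0 //; first by case/andP: q01.
  rewrite -[X in _ <= X](mean1 R rn); apply: ler_mean => G; by rewrite lern1 leq_b1.
apply: (@mean_resample_le _ _ _ S (fun G => (e * k <= #|F G|)%N%:R)
  (fun G => (e * #|nbs G (F G) :\: X G| < e.-1 * (r * #|F G|))%N%:R)) => //.
  by apply: (local_comp (fun x => (e * k <= #|pred_of_set x|)%N%:R)).
move=> G; have [kF _|_] := leqP (e * k) _; last by rewrite eqxx.
apply: (@le_trans _ _ (mean (fun H => (e * #|nbs H (F G) :\: X G| < e.-1 * (r * #|F G|))%N%:R))).
  apply: ler_mean => H; rewrite (local_mix _ _ lF) (local_mix _ _ lX).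
  rewrite (@agree_nbs _ _ H (mix _ _ _)) // => z zF; rewrite ffunE.
  by have := disjointFr (dFS G) zF => ->.
apply: mean_growth => //; apply: le_trans hq; apply: ler_wpM2r; first exact: exprn_ge0.
by apply: ler_wpM2r; rewrite ?invr_ge0 //; apply: ler_wpM2l; rewrite // ler_nat.
Qed.

Lemma mean_hits_local (S F I : D -> {set V}) (M N m : nat) :
  local S S -> local S F -> local S I -> (forall G, [disjoint F G & S G]) -> (N <= n)%N ->
  mean (fun G => [&& M <= #|F G|, N <= #|I G| & #|nbs G (F G) :&: I G| < m]%N%:R)
    <= n%:R ^+ m * (1 - (N - m)%:R / n%:R) ^+ M :> R.
Proof.
move=> lS lF lI dFS Nn.
have n0 : (0 < n)%N by rewrite (leq_trans _ rn).
have x01 (x : nat) : (x <= n)%N -> 0 <= (1 - x%:R / n%:R : R) <= 1.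
  move=> xn; rewrite subr_ge0 ler_pdivrMr ?ltr0n // mul1r ler_nat xn /=.
  by rewrite gerBl divr_ge0.
set b := (X in _ <= X).
have b0 : 0 <= b.
  by rewrite /b mulr_ge0 ?exprn_ge0 //; case/andP: (x01 (N - m)%N (leq_trans (leq_subr _ _) Nn)).
pose W G : R := ((M <= #|F G|) && (N <= #|I G|))%N%:R.
have -> : mean (fun G => [&& M <= #|F G|, N <= #|I G| & #|nbs G (F G) :&: I G| < m]%N%:R)
  = mean (fun G => W G * (#|nbs G (F G) :&: I G| < m)%N%:R).
  by apply: eq_mean => G; rewrite -natrM mulnb andbA.
apply: (@le_trans _ _ (b * mean W)); last first.
  rewrite ler_piMr // -[X in _ <= X](mean1 R rn); apply: ler_mean => G.
  by rewrite lern1 leq_b1.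
apply: (@mean_resample_le _ _ _ S W (fun G => (#|nbs G (F G) :&: I G| < m)%N%:R)) => //.
  by apply: (local_comp2 (fun x y => ((M <= #|pred_of_set x|) && (N <= #|pred_of_set y|))%N%:R)).
move=> G; rewrite /W; case: andP => [[MF NI] _|_]; last by rewrite eqxx.
apply: (@le_trans _ _ (mean (fun H => (#|nbs H (F G) :&: I G| < m)%N%:R))).
  apply: ler_mean => H; rewrite (local_mix _ _ lF) (local_mix _ _ lI).
  rewrite (@agree_nbs _ _ H (mix _ _ _)) // => z zF; rewrite ffunE.
  by have := disjointFr (dFS G) zF => ->.
apply: le_trans (mean_hits R rn _ _ _ (Ordinal r0) n0) _.
have In : (#|I G| <= n)%N by rewrite -[X in (_ <= X)%N](card_ord n) max_card.
have [/andP[y0 y1] /andP[x0 x1]] := (x01 (#|I G| - m)%N (leq_trans (leq_subr _ _) In),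
   x01 (N - m)%N (leq_trans (leq_subr _ _) Nn)).
rewrite /b; apply: ler_wpM2l; first exact: exprn_ge0.
apply: (@le_trans _ _ ((1 - (N - m)%:R / n%:R) ^+ #|F G|)).
  apply: lerXn2r; rewrite ?nnegrE //; rewrite lerD2l lerN2; apply: ler_wpM2r; rewrite ?invr_ge0 //.
  by rewrite ler_nat leq_sub2r.
exact: ler_wiXn2l.
Qed.

Fixpoint ball G u i : {set V} :=
  if i is j.+1 then ball G u j :|: nbs G (ball G u j) else [set u].

Lemma sub_ballS G u i : ball G u i \subset ball G u i.+1.
Proof. exact: subsetUl. Qed.

Lemma ball_self G u i : u \in ball G u i.
Proof. by elim: i => [|i IH] /=; rewrite ?inE // IH. Qed.

Lemma card_ball G u i : (#|ball G u i| <= r.+1 ^ i)%N.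
Proof.
elim: i => [|i IH] /=; first by rewrite cards1.
apply: leq_trans (leq_card_setU _ _) _; rewrite expnS mulSn.
by apply: leq_add => //; apply: leq_trans (card_nbs _ _) _; rewrite leq_mul2l IH orbT.
Qed.

Lemma local_ballS u i : local (fun G => ball G u i) (fun G => ball G u i.+1).
Proof.
elim: i => [|i IH] G H e /=; first by rewrite (agree_nbs e).
have e' : agree (ball G u i) G H by move=> z zb; apply: e; apply: (subsetP (sub_ballS _ _ _)).
have eqb : ball H u i.+1 = ball G u i.+1 := IH G H e'.
by rewrite -/(ball H u i.+1) -/(ball G u i.+1) eqb (agree_nbs e).
Qed.

Lemma local_ball u i : local (fun G => ball G u i) (fun G => ball G u i).
Proof.
by case: i => [|i] //; apply: localW (@local_ballS u i) => G; apply: sub_ballS.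
Qed.

(** A state of the shell is at distance exactly [i.+1], so a shortest path takes exactly this many
    steps, each of probability at least 1/r. *)
Lemma ptrans_shell G u i w : w \in ball G u i.+1 :\: ball G u i ->
  r%:R^-1 ^+ i.+1 <= ptrans R G i.+1 u w.
Proof.
have stp k x z c (p : R) : p <= ptrans R G k x z -> r%:R^-1 * p <= ptrans R G k.+1 x (step G z c).
  move=> h; apply: le_trans _ (ptrans_step R G k x z c).
  by apply: ler_wpM2l; rewrite ?invr_ge0.
elim: i w => [|i IH] w; rewrite in_setD => /andP[nb]; rewrite [ball G u _.+1]/= in_setU (negbTE nb) => /nbsP[z [c [zb we]]].
  move: zb; rewrite inE => /eqP zu; rewrite {}we {}zu exprS expr0.
  by apply: stp; rewrite /= eqxx.
rewrite {}we in nb *; rewrite exprS; apply: stp; apply: IH.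
rewrite inE zb andbT; apply: contra nb => zb'.
by rewrite /= inE; apply/orP; right; apply/nbsP; exists z, c.
Qed.

Section Pair.
Variables (u v : V) (i : nat).

(* (revealed states, front of u, front of v); the fronts are unrevealed and
   disjoint, and their states are reached in exactly i.+1 + k steps. *)
Fixpoint explore G k : {set V} * {set V} * {set V} :=
  if k is k'.+1 then
    let: (E, A, B) := explore G k' in
    let E' := E :|: A :|: B in
    (E', nbs G A :\: E', nbs G B :\: (E' :|: nbs G A))
  else
    let E := ball G u i :|: ball G v i in
    let A := ball G u i.+1 :\: E in
    (E, A, ball G v i.+1 :\: (E :|: A)).

Definition revealed k G := (explore G k).1.1.
Definition frontl k G := (explore G k).1.2.
Definition frontr k G := (explore G k).2.

Lemma revealedS k G : revealed k.+1 G = revealed k G :|: frontl k G :|: frontr k G.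
Proof. by rewrite /revealed /frontl /frontr /=; case: (explore G k) => [[E A] B]. Qed.

Lemma frontlS k G : frontl k.+1 G = nbs G (frontl k G) :\: revealed k.+1 G.
Proof. by rewrite /revealed /frontl /frontr /=; case: (explore G k) => [[E A] B]. Qed.

Lemma frontrS k G :
  frontr k.+1 G = nbs G (frontr k G) :\: (revealed k.+1 G :|: nbs G (frontl k G)).
Proof. by rewrite /revealed /frontl /frontr /=; case: (explore G k) => [[E A] B]. Qed.

Lemma exploreE k G : explore G k = (revealed k G, frontl k G, frontr k G).
Proof. by rewrite /revealed /frontl /frontr; case: (explore G k) => [[E A] B]. Qed.

Lemma frontl_revealed k G : [disjoint frontl k G & revealed k G].
Proof.
case: k => [|k]; last rewrite frontlS; rewrite -setI_eq0; apply/eqP/setP => z;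
  by rewrite in_setI in_setD in_set0 andbAC andNb.
Qed.

Lemma frontr_revealed k G : [disjoint frontr k G & revealed k G :|: frontl k G].
Proof.
case: k => [|k]; rewrite -setI_eq0; apply/eqP/setP => z; first by rewrite in_setI in_setD in_set0 andbAC andNb.
rewrite frontrS frontlS in_setI in_setD !in_setU in_setD in_set0.
by case: (z \in revealed _ _) => //=; case: (z \in nbs G (frontl _ _)); rewrite ?andbF.
Qed.

Lemma local_explore k : local (revealed k) (explore^~ k).
Proof.
elim: k => [|k IH] G H e.
  have eu : agree (ball G u i) G H by move=> z zb; apply: e; rewrite inE zb.
  have ev : agree (ball G v i) G H by move=> z zb; apply: e; rewrite inE zb orbT.
  have := local_ball eu; have := local_ball ev; have := local_ballS eu; have := local_ballS ev.
  by move=> /= -> -> -> ->.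
have e' := IH G H _.
rewrite !exploreE; move: e; rewrite revealedS => e.
have : explore H k = explore G k by apply: e' => z zE; apply: e; rewrite !inE zE.
rewrite !exploreE => -[E1 E2 E3].
have nA : nbs H (frontl k G) = nbs G (frontl k G).
  by apply: agree_nbs => z zA; apply: e; rewrite !inE zA orbT.
have nB : nbs H (frontr k G) = nbs G (frontr k G).
  by apply: agree_nbs => z zA; apply: e; rewrite !inE zA !orbT.
by rewrite !frontlS !frontrS !revealedS E1 E2 E3 nA nB.
Qed.

Lemma local_revealed k : local (revealed k) (revealed k).
Proof. by apply: (local_comp (fun x => x.1.1)); apply: local_explore. Qed.

Lemma local_frontl k : local (revealed k) (frontl k).
Proof. by apply: (local_comp (fun x => x.1.2)); apply: local_explore. Qed.

Lemma local_frontr k : local (revealed k) (frontr k).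
Proof. by apply: (local_comp snd); apply: local_explore. Qed.

Let c0 := (r.+1 ^ i.+1)%N.

(** The constant 4 reproduces itself: the revealed set gains two fronts of size at most c0 r^(k+1),
    and its old bound 4 c0 r^k is at most 2 c0 r^(k+1) because r >= 2. *)
Lemma card_fronts k G :
  [/\ #|frontl k G| <= c0 * r ^ k, #|frontr k G| <= c0 * r ^ k
    & #|revealed k.+1 G| <= 4 * c0 * r ^ k]%N.
Proof.
elim: k => [|k [IH1 IH2 IH3]].
  have h1 : (#|frontl 0 G| <= c0)%N.
    by apply: leq_trans (subset_leq_card (subsetDl _ _)) (card_ball G u i.+1).
  have h2 : (#|frontr 0 G| <= c0)%N.
    by apply: leq_trans (subset_leq_card (subsetDl _ _)) (card_ball G v i.+1).
  rewrite expn0 !muln1; split=> //; rewrite revealedS.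
  apply: leq_trans (leq_card_setU _ _) _.
  have h0 : (#|revealed 0 G| <= c0 + c0)%N.
    apply: leq_trans (leq_card_setU _ _) _; apply: leq_add.
      exact: leq_trans (subset_leq_card (sub_ballS _ _ _)) (card_ball G u i.+1).
    exact: leq_trans (subset_leq_card (sub_ballS _ _ _)) (card_ball G v i.+1).
  by have := leq_cardU (revealed 0 G) (frontl 0 G); lia.
have g1 : (#|frontl k.+1 G| <= c0 * r ^ k.+1)%N.
  rewrite frontlS (leq_trans (subset_leq_card (subsetDl _ _))) //.
  by apply: leq_trans (card_nbs _ _) _; rewrite expnS mulnCA leq_mul2l IH1 orbT.
have g2 : (#|frontr k.+1 G| <= c0 * r ^ k.+1)%N.
  rewrite frontrS (leq_trans (subset_leq_card (subsetDl _ _))) //.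
  by apply: leq_trans (card_nbs _ _) _; rewrite expnS mulnCA leq_mul2l IH2 orbT.
split=> //; rewrite revealedS; apply: leq_trans (leq_card_setU _ _) _.
have := leq_cardU (revealed k.+1 G) (frontl k.+1 G).
have : (2 * (c0 * r ^ k) <= c0 * r ^ k.+1)%N by rewrite expnS mulnCA leq_mul2l leq_mul2r r2 !orbT.
by rewrite -mulnA in IH3 *; lia.
Qed.

(** A front grows by less than the factor (1 - 1/e) r. Only fronts with at least [e * k] states are
    concerned, which makes the failure probability a [k]-th power. *)
Definition stunted (e k j : nat) G :=
  ((e * k <= #|frontl j G|) && (e * #|frontl j.+1 G| < e.-1 * (r * #|frontl j G|)) ||
   (e * k <= #|frontr j G|) && (e * #|frontr j.+1 G| < e.-1 * (r * #|frontr j G|)))%N.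

(** The left front is resampled given [revealed j]. The right one is resampled given the left front
    too, whose images then count among the states to avoid. *)
Lemma mean_stunted e k j (q : R) : (0 < e)%N -> 0 <= q <= 1 ->
  r%:R * (4 * c0 * r ^ j.+1)%:R / n%:R * 2 ^+ e <= q ->
  mean (fun G => (stunted e k j G)%:R) <= 2 * q ^+ k.
Proof.
move=> e0 q01 hq; rewrite mulrDl !mul1r.
have rj : (r * (c0 * r ^ j) = c0 * r ^ j.+1)%N by rewrite expnS mulnCA.
have r2j : (4 * c0 * r ^ j <= 2 * (c0 * r ^ j.+1))%N.
  by rewrite -rj -mulnA; have := leq_mul r2 (leqnn (c0 * r ^ j)%N); lia.
have lr : local (fun G => revealed j G :|: frontl j G) (fun G => revealed j G :|: frontl j G).
  apply: (local_comp2 (@setU V)).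
    by apply: localW (@local_revealed j) => G; apply: subsetUl.
  by apply: localW (@local_frontl j) => G; apply: subsetUl.
have lS : local (revealed j) (revealed j.+1).
  move=> G H e1; rewrite !revealedS.
  by rewrite (local_revealed e1) (local_frontl e1) (local_frontr e1).
apply: le_trans (lerD (mean_growth_local (S := revealed j) (F := frontl j)
    (X := revealed j.+1) k _ _ _ _ _ e0 q01 hq)
  (mean_growth_local (S := fun G => revealed j G :|: frontl j G) (F := frontr j)
    (X := fun G => revealed j.+1 G :|: nbs G (frontl j G)) k _ _ _ _ _ e0 q01 hq)) => //.
- rewrite -meanD; apply: ler_mean => G; rewrite -natrD ler_nat /stunted frontlS frontrS.
  by case: (_ && _) => //; case: (_ && _).
- exact: local_revealed.
- exact: local_frontl.
- exact: frontl_revealed.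
- move=> G; have [h1 h2 h3] := card_fronts j G.
  have := leq_mul (leqnn r) h1; rewrite rj -mulnA; lia.
- by apply: localW (@local_frontr j) => G; apply: subsetUl.
- apply: (local_comp2 (@setU V)); first by apply: localW lS => G; apply: subsetUl.
  move=> G H e1; have e2 : agree (frontl j G) G H by move=> z zA; apply: e1; rewrite inE zA orbT.
  have e3 : agree (revealed j G) G H by move=> z zA; apply: e1; rewrite inE zA.
  by rewrite (local_frontl e3) (agree_nbs e2).
- exact: frontr_revealed.
move=> G; have [h1 h2 h3] := card_fronts j G.
have := leq_mul (leqnn r) h1; have := leq_mul (leqnn r) h2; rewrite rj -mulnA.
have := leq_cardU (revealed j.+1 G) (nbs G (frontl j G)).
by have := card_nbs G (frontl j G); lia.
Qed.

Lemma mean_missed j (M N m : nat) : (N <= n)%N ->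
  mean (fun G => [&& M <= #|frontr j G|, N <= #|nbs G (frontl j G)|
     & #|nbs G (frontr j G) :&: nbs G (frontl j G)| < m]%N%:R)
    <= n%:R ^+ m * (1 - (N - m)%:R / n%:R) ^+ M :> R.
Proof.
move=> Nn; apply: (mean_hits_local (S := fun G => revealed j G :|: frontl j G)
  (F := frontr j) (I := fun G => nbs G (frontl j G))) => //.
- apply: (local_comp2 (@setU V)).
    by apply: localW (@local_revealed j) => G; apply: subsetUl.
  by apply: localW (@local_frontl j) => G; apply: subsetUl.
- by apply: localW (@local_frontr j) => G; apply: subsetUl.
- move=> G H e1; have e2 : agree (frontl j G) G H by move=> z zA; apply: e1; rewrite inE zA orbT.
  have e3 : agree (revealed j G) G H by move=> z zA; apply: e1; rewrite inE zA.
  by rewrite (local_frontl e3) (agree_nbs e2).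
- exact: frontr_revealed.
Qed.

(** As (e - 1) r >= e, a front that is not stunted does not shrink, so it stays above the
    threshold. *)
Lemma growth_step e k a b : (1 < e)%N -> (e * k <= a)%N -> (e.-1 * (r * a) <= e * b)%N ->
  (e * k <= b)%N.
Proof.
move=> e1 ka h; apply: leq_trans ka _; rewrite -(leq_pmul2l (ltnW e1)).
apply: leq_trans h; rewrite mulnA leq_mul2r; apply/orP; right.
by have := leq_mul (leqnn e.-1) r2; lia.
Qed.

Lemma fronts_grow e k H G : (1 < e)%N -> (forall j, (j <= H)%N -> ~~ stunted e k j G) ->
  (e * k <= #|frontl 0 G|)%N -> (e * k <= #|frontr 0 G|)%N -> forall j, (j <= H.+1)%N ->
  [/\ e * k <= #|frontl j G|, e * k <= #|frontr j G|,
     (e.-1 * r) ^ j * #|frontl 0 G| <= e ^ j * #|frontl j G| &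
     (e.-1 * r) ^ j * #|frontr 0 G| <= e ^ j * #|frontr j G|]%N.
Proof.
move=> e1 ns kl kr; elim=> [|j IH] jH; first by rewrite !expn0 !mul1n.
have [h1 h2 h3 h4] := IH (ltnW jH).
have := ns j jH; rewrite /stunted h1 h2 /= negb_or -!leqNgt => /andP[g1 g2].
have mul a a0 b : ((e.-1 * r) ^ j * a0 <= e ^ j * a)%N -> (e.-1 * (r * a) <= e * b)%N ->
    ((e.-1 * r) ^ j.+1 * a0 <= e ^ j.+1 * b)%N.
  move=> x1 x2; have := leq_mul (leqnn (e.-1 * r)%N) x1; have := leq_mul (leqnn (e ^ j)) x2.
  by rewrite !expnS; lia.
split; [exact: growth_step h1 g1 | exact: growth_step h2 g2 | exact: mul h3 g1 | exact: mul h4 g2].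
Qed.

Lemma ptrans_nbs G k x (F : {set V}) w : (forall z, z \in F -> r%:R^-1 ^+ k <= ptrans R G k x z) ->
  w \in nbs G F -> r%:R^-1 ^+ k.+1 <= ptrans R G k.+1 x w.
Proof.
move=> h /nbsP[z [c [zF ->]]]; rewrite exprS; apply: le_trans _ (ptrans_step R G k x z c).
by apply: ler_wpM2l; rewrite ?invr_ge0 // h.
Qed.

Lemma ptrans_frontl k G w : w \in frontl k G -> r%:R^-1 ^+ (i.+1 + k) <= ptrans R G (i.+1 + k) u w.
Proof.
elim: k w => [|k IH] w; last by rewrite frontlS in_setD addnS => /andP[_]; apply: ptrans_nbs.
rewrite addn0 in_setD in_setU negb_or => /andP[/andP[h1 _] h2].
by apply: ptrans_shell; rewrite in_setD h1.
Qed.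

Lemma ptrans_frontr k G w : w \in frontr k G -> r%:R^-1 ^+ (i.+1 + k) <= ptrans R G (i.+1 + k) v w.
Proof.
elim: k w => [|k IH] w; last by rewrite frontrS in_setD addnS => /andP[_]; apply: ptrans_nbs.
rewrite addn0 in_setD 2!in_setU !negb_or => /andP[/andP[/andP[_ h1] _] h2].
by apply: ptrans_shell; rewrite in_setD h1.
Qed.

Lemma overlap_fronts k G :
  #|nbs G (frontr k G) :&: nbs G (frontl k G)|%:R * r%:R^-1 ^+ (i.+1 + k).+1
    <= overlap R G (i.+1 + k).+1 u v.
Proof.
set X := _ :&: _; rewrite mulr_natl -sumr_const big_mkcond; apply: ler_sum => w _.
case: ifP => [|_]; last by rewrite le_min !ptrans_ge0.
rewrite inE => /andP[wr wl]; rewrite le_min.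
rewrite (ptrans_nbs (@ptrans_frontl k G) wl); exact: (ptrans_nbs (@ptrans_frontr k G) wr).
Qed.

Lemma frontl0 G : [disjoint ball G u i.+1 & ball G v i.+1] ->
  frontl 0 G = ball G u i.+1 :\: ball G u i.
Proof.
move=> d; have dv : [disjoint ball G u i.+1 & ball G v i] := disjointWr (sub_ballS _ _ _) d.
rewrite [LHS]setDUr; have /setDidPl -> := dv.
by apply/setIidPl; apply: subsetDl.
Qed.

Lemma frontr0 G : [disjoint ball G u i.+1 & ball G v i.+1] ->
  frontr 0 G = ball G v i.+1 :\: ball G v i.
Proof.
rewrite disjoint_sym => d.
have du : [disjoint ball G v i.+1 & ball G u i] := disjointWr (sub_ballS _ _ _) d.
have dA : [disjoint ball G v i.+1 & frontl 0 G] := disjointWr (subsetDl _ _) d.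
rewrite [LHS]setDUr setDUr; have /setDidPl -> := du; have /setDidPl -> := dA.
by rewrite setIAC setIid setIC; apply/setIidPl; apply: subsetDl.
Qed.

End Pair.

(** Balls at least double at each radius up to [i], and the last shell is at least r - 1 times the
    ball of radius [i]. *)
Lemma card_shell G K u i :
  (forall A, (0 < #|A| <= K)%N -> (r * #|A| <= #|A :|: nbs G A|)%N) -> (r.+1 ^ i <= K)%N ->
  (2 ^ i <= #|ball G u i.+1 :\: ball G u i|)%N.
Proof.
move=> h iK; have grow j : (j <= i)%N -> (r * #|ball G u j| <= #|ball G u j.+1|)%N.
  move=> ji; apply: h; rewrite card_gt0; apply/andP; split.
    by apply/set0Pn; exists u; apply: ball_self.
  by rewrite (leq_trans (card_ball G u j)) // (leq_trans _ iK) // leq_exp2l.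
have b2 j : (j <= i)%N -> (2 ^ j <= #|ball G u j|)%N.
  elim: j => [|j IH] ji; first by rewrite card_gt0; apply/set0Pn; exists u; apply: ball_self.
  rewrite expnS; apply: leq_trans (grow j (ltnW ji)).
  by apply: leq_mul => //; apply: IH; apply: ltnW.
rewrite cardsDS ?sub_ballS //; have := grow i (leqnn i); have := b2 i (leqnn i).
have := leq_mul r2 (leqnn #|ball G u i|); lia.
Qed.

Lemma card_inball G d w i : (forall w, #|[set z | w \in succs (G z)]| <= d)%N ->
  (#|[set u | w \in ball G u i]| <= d.+1 ^ i)%N.
Proof.
move=> hd; elim: i w => [|i IH] w.
  by rewrite expn0 -[X in (_ <= X)%N](cards1 w); apply: subset_leq_card; apply/subsetP => u; rewrite !inE eq_sym.
apply: (@leq_trans #|[set u | w \in ball G u i] :|: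
    \bigcup_(z in [set z | w \in succs (G z)]) [set u | z \in ball G u i]|).
  apply: subset_leq_card; apply/subsetP => u; rewrite inE /= !in_setU inE.
  move=> /orP[->//|/bigcupP[z zb wz]]; apply/orP; right.
  by apply/bigcupP; exists z; rewrite inE.
apply: leq_trans (leq_cardU _ _) _; rewrite expnS mulSn; apply: leq_add => //.
apply: (@leq_trans (\sum_(z in [set z | w \in succs (G z)]) d.+1 ^ i)); last first.
  by rewrite sum_nat_const leq_mul2r hd orbT.
elim/big_ind2: _ => [|X1 n1 X2 n2 h1 h2|z _]; [by rewrite cards0 | | exact: IH].
by apply: leq_trans (leq_cardU _ _) _; apply: leq_add.
Qed.

(** Such a [u] lies in the backward ball of some state of the out-ball of [v]; indegrees bound
    backward balls. *)
Lemma card_touching G d v i : (forall w, #|[set z | w \in succs (G z)]| <= d)%N ->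
  (#|[set u | ~~ [disjoint ball G u i & ball G v i]]| <= r.+1 ^ i * d.+1 ^ i)%N.
Proof.
move=> hd; apply: (@leq_trans #|\bigcup_(w in ball G v i) [set u | w \in ball G u i]|).
  apply: subset_leq_card; apply/subsetP => u; rewrite inE => /pred0Pn[w /andP[wu wv]].
  by apply/bigcupP; exists w; rewrite ?inE.
apply: (@leq_trans (\sum_(w in ball G v i) d.+1 ^ i)); last first.
  by rewrite sum_nat_const leq_mul2r card_ball orbT.
elim/big_ind2: _ => [|X1 n1 X2 n2 h1 h2|z _]; [by rewrite cards0 | | exact: card_inball].
by apply: leq_trans (leq_cardU _ _) _; apply: leq_add.
Qed.

End Exploration.

(** * Overlap of transition laws *)

Section Mixing.
Variables (R : realFieldType) (n r : nat).
Hypotheses (rn : (r <= n)%N) (r2 : (2 <= r)%N).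
Local Notation V := 'I_n.
Local Notation L := (letter_map n r).
Local Notation D := {ffun V -> L}.
Implicit Types (G : D) (A B F X Q : {set V}) (u v w z : V).
Variables (i e k H d m M N k1 b : nat).

(** The four obstructions to mixing. Excluding them gives, in order: initial fronts of size at least
    2^i, few states whose out-ball touches a given one, sustained growth for all pairs, and a large
    common image at the end. *)
Definition slow_growth G :=
  [exists A : {set V}, (0 < #|A| <= r.+1 ^ i)%N && (#|A :|: nbs G A| < r * #|A|)%N].
Definition large_indegree G := [exists w, (d <= #|[set z | w \in succs (G z)]|)%N].
Definition some_stunted G :=
  [exists u, [exists v, [exists j : 'I_H.+1, stunted u v i e k j G]]].
Definition some_missed G := [exists u, [exists v,
  [&& M <= #|frontr u v i H G|, N <= #|nbs G (frontl u v i H G)|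
    & #|nbs G (frontr u v i H G) :&: nbs G (frontl u v i H G)| < m]%N]].

Let beta := (r.+1 ^ i.+1 * d.+1 ^ i.+1)%N.

(** [ek] puts the initial fronts above the threshold of [stunted]; [eb] bounds by [b] the total loss
    from growing by (1 - 1/e) r instead of r. *)
Hypotheses (e1 : (1 < e)%N) (ek : (e * k <= 2 ^ i)%N) (b0 : (0 < b)%N)
  (eb : forall j, (j <= H.+1)%N -> (e ^ j <= b * e.-1 ^ j)%N)
  (bM : (b * M <= r ^ H)%N) (bN : (b * N <= r ^ H.+1)%N)
  (k1H : (k1 <= H.+1)%N) (betab : (b * beta < r ^ k1)%N) (betan : (beta < n)%N).

Variable G : D.
Hypotheses (hslow : ~~ slow_growth G) (hin : ~~ large_indegree G)
  (hst : ~~ some_stunted G) (hmiss : ~~ some_missed G).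

Lemma front_sizes u v : [disjoint ball G u i.+1 & ball G v i.+1] -> forall j, (j <= H.+1)%N ->
  (r ^ j <= b * #|frontl u v i j G|)%N /\ (r ^ j <= b * #|frontr u v i j G|)%N.
Proof.
move=> duv j jH.
have hs A : (0 < #|A| <= r.+1 ^ i)%N -> (r * #|A| <= #|A :|: nbs G A|)%N.
  by move=> hA; rewrite leqNgt; apply: contra hslow => lt; apply/existsP; exists A; rewrite hA.
have sl : (2 ^ i <= #|frontl u v i 0 G|)%N by rewrite frontl0 //; apply: (card_shell rn r2 _ hs).
have sr : (2 ^ i <= #|frontr u v i 0 G|)%N by rewrite frontr0 //; apply: (card_shell rn r2 _ hs).
have ns j' : (j' <= H)%N -> ~~ stunted u v i e k j' G.
  rewrite -ltnS => jH'; apply: contra hst => st; apply/existsP; exists u.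
  by apply/existsP; exists v; apply/existsP; exists (Ordinal jH').
have [_ _ h1 h2] := fronts_grow rn r2 e1 ns (leq_trans ek sl) (leq_trans ek sr) jH.
have fin a0 a : (2 ^ i <= a0)%N -> ((e.-1 * r) ^ j * a0 <= e ^ j * a)%N -> (r ^ j <= b * a)%N.
  move=> ha0 ha; have a0p : (0 < a0)%N by apply: leq_trans ha0; rewrite expn_gt0.
  have ej0 : (0 < e ^ j)%N by rewrite expn_gt0 (ltnW e1).
  rewrite -(leq_pmul2l ej0); have := leq_mul (eb jH) (leqnn (r ^ j)).
  have := leq_mul (leqnn b) ha; have := leq_pmulr ((e.-1 * r) ^ j) a0p.
  rewrite expnMn => x1 x2 x3.
  have := leq_mul (leqnn b) x1; lia.
by split; [apply: (fin _ _ sl) | apply: (fin _ _ sr)].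
Qed.

Lemma indegree_le w : (#|[set z | w \in succs (G z)]| <= d)%N.
Proof.
apply: ltnW; rewrite ltnNge; apply: contra hin => h.
by apply/existsP; exists w.
Qed.

Lemma exists_disjoint_ball x A : (beta < #|A|)%N ->
  exists2 u, u \in A & [disjoint ball G u i.+1 & ball G x i.+1].
Proof.
move=> bA; have [/subsetP sub|/subsetPn[u uA]] :=
  boolP (A \subset [set u | ~~ [disjoint ball G u i.+1 & ball G x i.+1]]).
  have := subset_leq_card (introT subsetP sub); rewrite leqNgt.
  by rewrite (leq_ltn_trans (card_touching x i.+1 indegree_le)).
by rewrite inE negbK => duv; exists u.
Qed.

(** Some auxiliary [v] has an out-ball disjoint from that of [x], since fewer than [n] states fail;
    the front of [x] in the exploration of this pair serves as [A]. *)
Lemma exists_spread x : exists2 A : {set V}, (beta < #|A|)%N &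
  forall u, u \in A -> r%:R^-1 ^+ (i.+1 + k1) <= ptrans R G (i.+1 + k1) x u.
Proof.
have [|v _ dvx] := @exists_disjoint_ball x [set: V]; first by rewrite cardsT card_ord.
exists (frontl x v i k1 G) => [|u]; last exact: ptrans_frontl.
rewrite disjoint_sym in dvx; have [h _] := front_sizes dvx k1H.
by rewrite -(ltn_pmul2l b0) (leq_trans betab).
Qed.

(** Spread from [x] to [A] and from [y] to [B], fix [v] in [B], and use the size of [A] to find [u]
    in it with an out-ball disjoint from that of [v]. The fronts of this pair then have a common
    image. *)
Lemma mixing_overlap x y : (m <= n)%N ->
  r%:R^-1 ^+ (i.+1 + k1) * (m%:R * r%:R^-1 ^+ (i.+1 + H).+1)
    <= overlap R G ((i.+1 + k1) + (i.+1 + H).+1) x y.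
Proof.
move=> mn; have [A cA hA] := exists_spread x; have [B cB hB] := exists_spread y.
have [v vB] : exists v, v \in B by apply/set0Pn; rewrite -card_gt0 (leq_ltn_trans _ cB).
have [u uA duv] := exists_disjoint_ball v cA.
apply: le_trans _ (overlapD (i.+1 + H).+1 _ (hA u uA) (hB v vB)); last by rewrite exprn_ge0 ?invr_ge0.
apply: ler_wpM2l; first by rewrite exprn_ge0 ?invr_ge0.
apply: le_trans _ (overlap_fronts R u v i H G); apply: ler_wpM2r; first by rewrite exprn_ge0 ?invr_ge0.
rewrite ler_nat leqNgt; apply: contra hmiss => lt; apply/existsP; exists u; apply/existsP; exists v.
have [_ hM] := front_sizes duv (leqnSn H); have [hN _] := front_sizes duv (leqnn H.+1).
rewrite lt andbT -(leq_pmul2l b0) (leq_trans bM hM) -(leq_pmul2l b0) (leq_trans bN) //.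
apply: leq_trans hN _; rewrite leq_mul2l; apply/orP; right.
by rewrite frontlS; apply: subset_leq_card; apply: subsetDl.
Qed.

End Mixing.

Lemma mean_exists_le (R : realFieldType) (T I : finType) (E : I -> pred T) (p : R) :
  (forall i, mean (fun x => (E i x)%:R) <= p) ->
  mean (fun x => [exists i, E i x]%:R) <= #|I|%:R * p.
Proof.
move=> h; apply: (@le_trans _ _ (\sum_i mean (fun x => (E i x)%:R))).
  rewrite -mean_sum; apply: ler_mean => x; case: existsP => [[i Ei]|_]; last exact: sumr_ge0.
  by rewrite (bigD1 i) //= Ei lerDl; apply: sumr_ge0.
apply: (@le_trans _ _ (\sum_(i : I) p)); first exact: ler_sum.
by rewrite sumr_const mulr_natl.
Qed.

Lemma mean_or (R : realFieldType) (T : finType) (E F : pred T) (p q : R) :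
  mean (fun x => (E x)%:R) <= p -> mean (fun x => (F x)%:R) <= q ->
  mean (fun x => (E x || F x)%:R) <= p + q.
Proof.
move=> hE hF; apply: le_trans (lerD hE hF); rewrite -meanD; apply: ler_mean => x.
by rewrite -natrD ler_nat; case: (E x); case: (F x).
Qed.

Section NotMixing.
Variables (R : realFieldType) (n r : nat).
Hypotheses (rn : (r <= n)%N) (r2 : (2 <= r)%N).
Local Notation V := 'I_n.
Local Notation L := (letter_map n r).
Local Notation D := {ffun V -> L}.
Variables (i e k H d m M N : nat).

Definition not_mixing (G : D) := slow_growth i G || (large_indegree d G ||
  (some_stunted i e k H G || some_missed i H m M N G)).

Lemma mean_not_mixing (q : R) : (0 < e)%N -> 0 <= q <= 1 -> (N <= n)%N ->
  r%:R * (4 * r.+1 ^ i.+1 * r ^ H.+1)%:R / n%:R * 2 ^+ e <= q ->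
  mean (fun G => (not_mixing G)%:R) <=
   (r.+1 ^ i * (2 * (r * r.+1 ^ i)) ^ (r * r.+1 ^ i))%:R / n%:R +
   (n%:R * r%:R ^+ d / d`!%:R +
   (n%:R * (n%:R * (H.+1%:R * (2 * q ^+ k))) +
    n%:R * (n%:R * (n%:R ^+ m * (1 - (N - m)%:R / n%:R) ^+ M)))).
Proof.
move=> e0 q01 Nn hq; have r0 : (0 < r)%N by apply: ltnW.
have n0 : (0 < n)%N by rewrite (leq_trans r0).
apply: mean_or; first exact: mean_small_growth.
apply: mean_or; first exact: mean_indegree.
apply: mean_or.
  rewrite -[X in X%:R * (X%:R * _)](card_ord n); apply: mean_exists_le => u.
  apply: mean_exists_le => v; rewrite -[X in X%:R * _](card_ord H.+1); apply: mean_exists_le => j.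
  apply: mean_stunted => //; apply: le_trans hq.
  apply: ler_wpM2r; first exact: exprn_ge0.
  apply: ler_wpM2r; rewrite ?invr_ge0 //; apply: ler_wpM2l => //.
  by rewrite ler_nat leq_mul2l leq_pexp2l ?orbT // ltnS.
rewrite -[X in X%:R * (X%:R * _)](card_ord n); apply: mean_exists_le => u.
by apply: mean_exists_le => v; apply: mean_missed.
Qed.

End NotMixing.

(** * Choice of scales *)

Lemma bernoulli_nat e j : (j <= e)%N -> (e ^ j * (e - j) <= e * e.-1 ^ j)%N.
Proof.
elim: j => [|j IH] je; first by rewrite !expn0 mul1n muln1 subn0.
rewrite !expnS; have h := IH (ltnW je).
have h1 : (e * (e - j.+1) <= e.-1 * (e - j))%N by case: (e) je => // e' je; nia.
have := leq_mul (leqnn (e ^ j)) h1; have := leq_mul (leqnn e.-1) h; lia.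
Qed.

(** By Bernoulli, [e] steps at loss rate 1/(2e) lose at most a factor 2, so [e * l] steps lose at
    most 2^l <= r^l. *)
Lemma expn_ratio_le e r l j : (0 < e)%N -> (2 <= r)%N -> (j <= e * l)%N ->
  ((2 * e) ^ j <= r ^ l * (2 * e).-1 ^ j)%N.
Proof.
move=> e0 r2 jl; have h1 : ((2 * e) ^ e <= 2 * (2 * e).-1 ^ e)%N.
  have := @bernoulli_nat (2 * e) e; have -> : (2 * e - e = e)%N by lia.
  rewrite -mulnA [(e * _ ^ _)%N]mulnC mulnA => h; rewrite -(leq_pmul2r e0).
  by apply: h; lia.
have h2 : ((2 * e) ^ (e * l) <= r ^ l * (2 * e).-1 ^ (e * l))%N.
  rewrite !expnM; case: (posnP l) => [->|l0]; first by [].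
  by rewrite -expnMn leq_exp2r // (leq_trans h1) // leq_mul2r r2 orbT.
have p0 : (0 < (2 * e).-1 ^ (e * l - j))%N by rewrite expn_gt0; lia.
rewrite -(leq_pmul2r p0) -mulnA -expnD subnKC //; apply: leq_trans h2.
apply: (@leq_trans ((2 * e) ^ j * (2 * e) ^ (e * l - j))); last by rewrite -expnD subnKC.
by rewrite leq_mul2l; apply/orP; right; case: (e * l - j)%N => // p; rewrite leq_exp2r // leq_pred.
Qed.

Section HalfPower.
Variable R : realFieldType.

(** Each block of [x] factors is at most 1/2, because (1 - t)^x (1 + t)^x <= 1 and (1 + t)^x >= 1 +
    x t >= 2. *)
Lemma half_power (x y M : nat) (t : R) : (0 < x)%N -> (x * y <= M)%N -> x%:R^-1 <= t <= 1 ->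
  (1 - t) ^+ M <= 2^-1 ^+ y.
Proof.
move=> x0 xyM /andP[xt t1]; have x0' : 0 < x%:R :> R by rewrite ltr0n.
have t0 : 0 < t by apply: lt_le_trans xt; rewrite invr_gt0.
have u01 : 0 <= 1 - t <= 1 by apply/andP; split; lra.
apply: (@le_trans _ _ ((1 - t) ^+ (x * y))).
  by apply: ler_wiXn2l => //; case/andP: u01.
rewrite exprM; apply: lerXn2r; rewrite ?nnegrE ?exprn_ge0 ?invr_ge0 //; first by case/andP: u01.
have bern k : 1 + k%:R * t <= (1 + t) ^+ k.
  elim: k => [|k IH]; first by rewrite mul0r addr0 expr0.
  rewrite exprS; apply: (@le_trans _ _ ((1 + t) * (1 + k%:R * t))).
    by rewrite -[k.+1]add1n natrD; have := mulr_ge0 (ler0n R k) (sqr_ge0 t); rewrite expr2; lra.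
  by apply: ler_wpM2l => //; lra.
have two : 2 <= (1 + t) ^+ x.
  apply: le_trans (bern x); have : 1 <= x%:R * t.
    by rewrite mulrC -ler_pdivrMr // div1r.
  by lra.
rewrite -div1r ler_pdivlMr //.
apply: (@le_trans _ _ ((1 - t) ^+ x * (1 + t) ^+ x)).
  by apply: ler_wpM2l => //; rewrite exprn_ge0 //; case/andP: u01.
rewrite -exprMn; apply: exprn_ile1; first by apply: mulr_ge0; lra.
by have := sqr_ge0 t; rewrite expr2; lra.
Qed.

End HalfPower.

Definition lag l i := ((i.+1 + 3 * l) + (i.+1 + 97 * l).+1)%N.

Lemma lag_le b l i : (100 * l + (i.+1 + i.+2) <= b)%N -> (lag l i <= b)%N.
Proof. by rewrite /lag; lia. Qed.

(* Every scale is a power of b = r ^ l, where n is b ^ 100 up to a constant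
   factor: the fronts are grown for 97 * l steps to at least b ^ 96 states, their
   images share b ^ 88 of them, and walks of 3 * l steps lead to disjoint balls. *)
Section Scale.
Variables (R : realFieldType) (n r l i e : nat).
Hypotheses (rn : (r <= n)%N) (r2 : (2 <= r)%N).
Local Notation V := 'I_n.
Local Notation L := (letter_map n r).
Local Notation D := {ffun V -> L}.
Let b := (r ^ l)%N.
Hypotheses (nlo : (b ^ 100 <= n)%N) (nhi : (n <= b ^ 101)%N) (b400 : (400 <= b)%N).
Hypotheses (ek : (e * 205 <= 2 ^ i)%N) (e1 : (1 < e)%N)
  (eb : forall j, (j <= 100 * l)%N -> (e ^ j <= b * e.-1 ^ j)%N)
  (ce : (4 * r ^ 2 * r.+1 ^ i.+1 * 2 ^ e <= b)%N)
  (cl : (r.+1 ^ i.+1 * l.+1 ^ i.+1 <= b)%N)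
  (ci : (r ^ (i.+1 + i.+2) <= b)%N) (lb : (100 * l + (i.+1 + i.+2) <= b)%N).

Definition unmixed (G : D) := not_mixing i e 205 (97 * l) l (b ^ 88) (b ^ 96) (b ^ 96) G.

Let b0 : (0 < b)%N. Proof. by lia. Qed.
Let l0 : (0 < l)%N.
Proof. by move: b400; rewrite /b; case: (l). Qed.

Lemma overlap_lag (G : D) x y : ~~ unmixed G -> b%:R^-1 ^+ 13 <= overlap R G (lag l i) x y.
Proof.
rewrite /unmixed /not_mixing !negb_or => /andP[h1 /andP[h2 /andP[h3 h4]]].
have rl (j : nat) : (r ^ (j * l) = b ^ j)%N by rewrite mulnC expnM.
apply: le_trans (@mixing_overlap R n r rn r2 i e 205 (97 * l) l (b ^ 88) (b ^ 96) (b ^ 96) (3 * l) b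
   e1 ek b0 _ _ _ _ _ _ G h1 h2 h3 h4 x y _).
- rewrite -/(b ^ 88)%N.
  (* The two exponents add up to [100 * l] plus a constant; [ci] charges the constant to one more
     [b], so the overlap is at least b^88 / b^101. *)
  have -> : r%:R^-1 ^+ (i.+1 + 3 * l) * ((b ^ 88)%:R * r%:R^-1 ^+ (i.+1 + 97 * l).+1)
    = (b ^ 88)%:R / (r ^ (i.+1 + i.+2) * b ^ 100)%:R :> R.
    rewrite mulrCA -exprD exprVn -(rl 100%N) -expnD [(r ^ _)%:R]natrX; congr (_ / _ ^+ _); lia.
  rewrite exprVn -div1r ler_pdivlMr ?ltr0n ?muln_gt0 ?expn_gt0 ?b0 ?(ltnW r2) //.
  rewrite mulrAC mul1r ler_pdivrMr ?exprn_gt0 ?ltr0n // -natrX -natrM ler_nat.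
  by rewrite -expnD -[(88 + 13)%N]/(100.+1) (expnS b) leq_mul2r ci orbT.
- by move=> j jl; apply: eb; move: jl l0; lia.
- by rewrite rl -expnS.
- by rewrite (expnS r) rl -expnS (leq_trans (leq_pmull _ (ltnW r2))).
- by move: l0; lia.
- rewrite rl; apply: (@leq_ltn_trans (b * b)); first by rewrite leq_mul2l cl orbT.
  by rewrite mulnn ltn_exp2l //; lia.
- apply: leq_ltn_trans cl _; apply: leq_trans nlo.
  by rewrite -[X in (X < _)%N]expn1 ltn_exp2l //; lia.
- by apply: leq_trans nlo; rewrite leq_exp2l //; lia.
Qed.

Let b1 : (1 < b)%N. Proof. by apply: leq_trans b400. Qed.

Let bp j : (0 < b ^ j)%N. Proof. by rewrite expn_gt0; apply/orP; left; apply: b0. Qed.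

Let missed_small :
  n%:R * (n%:R * (n%:R ^+ (b ^ 88) * (1 - (b ^ 96 - b ^ 88)%:R / n%:R) ^+ (b ^ 96))) <= b%:R^-1 :> R.
Proof.
have n0 : (0 < n)%N by rewrite (leq_trans _ rn) // ltnW.
(* The fraction of targets is at least b^-6, as n <= b^101, so the b^96 states of the front give
   b^90 halvings. *)
have hp : (1 - (b ^ 96 - b ^ 88)%:R / n%:R) ^+ (b ^ 96) <= 2^-1 ^+ (b ^ 90) :> R.
  apply: (half_power (x := (b ^ 6)%N)); first exact: bp.
    by rewrite -expnD.
  rewrite ler_pdivlMr ?ltr0n // ler_pdivrMr ?ltr0n // mul1r ler_nat andbC.
  have h96 : (b ^ 96 <= b ^ 100)%N by rewrite leq_exp2l.
  rewrite (leq_trans (leq_subr _ _) (leq_trans h96 nlo)) /=.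
  rewrite ler_pdivrMl ?ltr0n ?bp // -natrM ler_nat (leq_trans nhi) //.
  rewrite mulnBr -!expnD -[(6 + 96)%N]/(101.+1) (expnS b).
  have h94 : (b ^ 94 <= b ^ 101)%N by rewrite leq_exp2l.
  rewrite -[(6 + 88)%N]/94%N leq_subRL; last first.
    by apply: leq_trans h94 _; rewrite leq_pmull ?b0.
  by apply: leq_trans (leq_add h94 (leqnn _)) _; rewrite addnn -mul2n leq_mul2r b1 orbT.
(* The tuples and the pairs of states number n^q with q = b^88 + 2. Since n <= b^101 and b <= 2^b,
   the exponent of 2 is about 101 b^89, below b^90 because b >= 400. *)
have e2 : (b * (n ^ (b ^ 88).+2) <= 2 ^ (b ^ 90))%N.
  have gen q : (b * n ^ q <= 2 ^ (b * (101 * q).+1))%N.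
    apply: (@leq_trans (b ^ (101 * q).+1)).
      by rewrite [(b ^ _.+1)%N]expnS leq_mul2l expnM; case: (q) => [|q']; rewrite ?orbT // leq_exp2r ?nhi ?orbT.
    by rewrite expnM leq_exp2r // ltnW // ltn_expl.
  apply: leq_trans (gen _) _; rewrite leq_exp2l //.
  have h1 : (1 <= b ^ 88)%N := bp 88.
  apply: (@leq_trans (b * (b * b ^ 88))); last by rewrite -!expnS.
  rewrite leq_mul2l; apply/orP; right.
  move: (b ^ 88)%N h1 => q q0; apply: leq_trans (leq_mul b400 (leqnn q)).
  by clear -q0; lia.
rewrite -[b%:R^-1]mul1r ler_pdivlMr ?ltr0n //.
apply: (@le_trans _ _ (n%:R * (n%:R * (n%:R ^+ (b ^ 88) * 2^-1 ^+ (b ^ 90))) * b%:R)).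
  by apply: ler_wpM2r => //; do 2!apply: ler_wpM2l => //; apply: ler_wpM2l; rewrite ?exprn_ge0.
rewrite !(mulrA n%:R (n%:R ^+ _)) -exprS !(mulrA n%:R (n%:R ^+ _)) -exprS exprVn mulrAC ler_pdivrMr ?exprn_gt0 // mul1r mulrC.
by rewrite -!natrX -natrM ler_nat.
Qed.

Lemma mean_unmixed : mean (fun G : D => (unmixed G)%:R) <=
  (r.+1 ^ i * (2 * (r * r.+1 ^ i)) ^ (r * r.+1 ^ i) + 2)%:R / b%:R
    + (r%:R ^+ 102) ^+ l / l`!%:R :> R.
Proof.
have n0 : (0 < n)%N by rewrite (leq_trans _ rn) // ltnW.
have bn : (b <= n)%N by apply: leq_trans nlo; rewrite -[X in (X <= _)%N]expn1 leq_exp2l.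
have bi0 : 0 <= b%:R^-1 :> R by rewrite invr_ge0.
have q01 : 0 <= (b%:R^-1 : R) <= 1 by rewrite bi0 invf_le1 ?ltr0n // ler1n.
have h96 : (b ^ 96 <= n)%N by apply: leq_trans nlo; rewrite leq_exp2l.
apply: le_trans (mean_not_mixing rn r2 205 l (b ^ 88) (b ^ 96) (ltnW e1) q01 h96 _) _.
  rewrite mulrAC ler_pdivrMr ?ltr0n // ler_pdivlMl ?ltr0n // -natrX -!natrM ler_nat.
  have -> : (r ^ (97 * l).+1 = r * b ^ 97)%N by rewrite expnS [(97 * l)%N]mulnC expnM.
  apply: leq_trans nlo; apply: (@leq_trans (b * b ^ 98)); last by rewrite -expnS leq_exp2l.
  apply: leq_trans (leq_mul ce (leqnn (b ^ 98))).
  rewrite -[(b ^ 98)%N]/(b ^ 97.+1)%N (expnS b) -[(r ^ 2)%N]/(r * r)%N.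
  by move: (b ^ 97)%N (2 ^ e)%N (r.+1 ^ i.+1)%N b => p q c b'; apply: eq_leq; ring.
rewrite [(_ + 2)%:R]natrD [(_ + 2) / _]mulrDl -[X in _ <= X]addrA; apply: lerD.
  apply: ler_wpM2l => //; rewrite lef_pV2 ?posrE ?ltr0n // ler_nat //.
rewrite [X in _ <= X]addrC; apply: lerD.
  apply: ler_wpM2r; first by rewrite invr_ge0.
  rewrite -exprM -!natrX -natrM ler_nat -[102%N]/(101 + 1)%N mulnDl mul1n expnD.
  by rewrite leq_mul2r [(101 * l)%N]mulnC expnM nhi orbT.
rewrite [X in _ <= X](_ : _ = b%:R^-1 + b%:R^-1); last by rewrite mulr_natl mulr2n.
apply: lerD; last exact: missed_small.
(* Origin of 205: the pairs number at most b^202, the times at most b and the factor 2 is at most b,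
   so b^-205 leaves 1/b. *)
rewrite exprVn !mulrA ler_pdivrMr ?exprn_gt0 ?ltr0n // -[205%N]/(1 + 204)%N exprD expr1 mulKf; last first.
  by rewrite pnatr_eq0 -lt0n b0.
rewrite -natrX -!natrM ler_nat.
apply: (@leq_trans (b ^ 101 * b ^ 101 * b * b)); last by rewrite -expnD -!expnSr.
apply: leq_mul b1; apply: leq_mul; first exact: leq_mul.
by apply: leq_trans lb; clear; lia.
Qed.

End Scale.

Lemma sqr_mean_le (R : realFieldType) (T : finType) (phi : T -> R) :
  (0 < #|T|)%N -> mean phi ^+ 2 <= mean (fun x => phi x ^+ 2).
Proof.
move=> T0; have := mean_ge0 (fun x => sqr_ge0 (phi x - mean phi)).
have -> : mean (fun x => (phi x - mean phi) ^+ 2) = mean (fun x => phi x ^+ 2) - mean phi ^+ 2.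
  have e x : (phi x - mean phi) ^+ 2 = phi x ^+ 2 - (2 * mean phi) * phi x + mean phi ^+ 2 by ring.
  by rewrite (eq_mean e) meanD meanB meanZ mean_cst //; ring.
by rewrite subr_ge0.
Qed.

Lemma mean_swap (R : realFieldType) (S T : finType) (phi : S -> T -> R) :
  mean (fun x => mean (phi x)) = mean (fun y => mean (phi^~ y)).
Proof. by rewrite /mean -!mulr_sumr mulrCA exchange_big. Qed.

(** * Concentration of the meeting count averaged over words *)

Section MeanMeetCount.
Variables (R : realFieldType) (n r : nat).
Hypotheses (rn : (r <= n)%N) (r0 : (0 < r)%N).
Local Notation D := {ffun 'I_n -> letter_map n r}.
Variables (s T : nat) (c0 : 'I_r).

Definition mean_meet_count (G : D) : R :=
  mean (fun a : (s + T).-tuple 'I_r => mean (fun b : (s + T).-tuple 'I_r =>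
     meet_count R (nth c0 a) (nth c0 b) s T G)).

(** Chebyshev's inequality. The variance bound holds for each pair of words, and by convexity of the
    square it survives averaging over them. *)
Lemma mean_low_count (delta : R) : (0 < T)%N -> 0 < delta ->
  mean (fun G => (mean_meet_count G < (1 - delta) * (T%:R * n%:R))%R%:R)
   <= (18 * (s + T) ^ 4)%:R / n%:R / delta ^+ 2.
Proof.
move=> T0 d0; have n0 : (0 < n)%N by rewrite (leq_trans r0).
have nT : 0 < T%:R * n%:R :> R by rewrite mulr_gt0 ?ltr0n.
have w0 : (0 < #|{: (s + T).-tuple 'I_r}|)%N by rewrite card_tuple card_ord expn_gt0 r0.
have var : mean (fun G => (mean_meet_count G - T%:R * n%:R) ^+ 2) <= (18 * T ^ 2 * (s + T) ^ 4 * n)%:R.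
  pose W := (s + T).-tuple 'I_r.
  apply: (@le_trans _ _ (mean (fun G : D => mean (fun a : W => mean (fun b : W =>
     (meet_count R (nth c0 a) (nth c0 b) s T G - T%:R * n%:R) ^+ 2))))).
    apply: ler_mean => G.
    have -> : mean_meet_count G - T%:R * n%:R = mean (fun a : W => mean (fun b : W =>
       meet_count R (nth c0 a) (nth c0 b) s T G - T%:R * n%:R)).
      rewrite -[T%:R * n%:R in LHS](mean_cst (T := W)) // -meanB; apply: eq_mean => a.
      by rewrite meanB mean_cst.
    by apply: le_trans (sqr_mean_le _ w0) _; apply: ler_mean => a; apply: sqr_mean_le.
  rewrite mean_swap -[X in _ <= X](mean_cst (T := W)) //; apply: ler_mean => a.
  rewrite mean_swap -[X in _ <= X](mean_cst (T := W)) //; apply: ler_mean => b.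
  by apply: meet_count_variance => //; rewrite addn_gt0 T0 orbT.
rewrite ler_pdivlMr ?exprn_gt0 // ler_pdivlMr ?ltr0n //.
have : mean (fun G => (mean_meet_count G < (1 - delta) * (T%:R * n%:R))%R%:R) * (delta * (T%:R * n%:R)) ^+ 2
   <= (18 * T ^ 2 * (s + T) ^ 4 * n)%:R.
  apply: le_trans var; rewrite -meanZr; apply: ler_mean => G.
  case: ltP => [lt|_]; last by rewrite mul0r sqr_ge0.
  rewrite mul1r -[X in _ <= X]sqrrN; apply: lerXn2r; rewrite ?nnegrE ?mulr_ge0 ?(ltW d0) //.
    by have := mulr_gt0 d0 nT; lra.
  by lra.
set p := mean _ => h; rewrite -(ler_pM2r (x := T%:R ^+ 2 * n%:R)); last by rewrite mulr_gt0 ?exprn_gt0 ?ltr0n.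
by move: h; rewrite !natrM ?natrX; lra.
Qed.

End MeanMeetCount.

(** * Geometric tail on a regular DFA *)

Section ScaleTail.
Variables (R : realType) (n r l i e : nat).
Hypotheses (rn : (r <= n)%N) (r2 : (2 <= r)%N).
Local Notation V := 'I_n.
Local Notation D := {ffun V -> letter_map n r}.
Let b := (r ^ l)%N.
Hypotheses (nlo : (b ^ 100 <= n)%N) (nhi : (n <= b ^ 101)%N) (b400 : (400 <= b)%N).
Hypotheses (ek : (e * 205 <= 2 ^ i)%N) (e1 : (1 < e)%N)
  (eb : forall j, (j <= 100 * l)%N -> (e ^ j <= b * e.-1 ^ j)%N)
  (ce : (4 * r ^ 2 * r.+1 ^ i.+1 * 2 ^ e <= b)%N)
  (cl : (r.+1 ^ i.+1 * l.+1 ^ i.+1 <= b)%N)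
  (ci : (r ^ (i.+1 + i.+2) <= b)%N) (lb : (100 * l + (i.+1 + i.+2) <= b)%N)
  (cb : (2 * b ^ 101 <= 2 ^ b)%N).

(** [B] lags at overlap b^-13 halve the oscillation [b] times, enough to bring it below 1/n. The
    choice of [T] leaves a factor b^2 over the burn-in [s]. *)
Let B := (b ^ 14)%N.
Let s := (B * lag l i)%N.
Let T := (b ^ 17)%N.
Let rate : R := b%:R / b.+1%:R / n%:R.
Let c0 : 'I_r := Ordinal (ltnW r2).

Definition irregular (G : D) := unmixed l i e G ||
  (mean_meet_count R s T c0 G < (1 - b%:R^-1 ^+ 2) * (T%:R * n%:R)).

Let b0 : (0 < b)%N. Proof. by apply: leq_trans b400. Qed.
Let n0 : (0 < n)%N. Proof. by apply: leq_trans rn; apply: ltnW. Qed.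
Let bR : 400 <= b%:R :> R. Proof. by rewrite ler_nat. Qed.

Let s_le : (s <= b ^ 15)%N.
Proof. by rewrite (expnSr b 14); apply: leq_mul; [apply: leqnn | apply: (lag_le lb)]. Qed.

Lemma avoid_regular (G : D) x y : ~~ irregular G -> avoid R G (s + T) x y <= 1 - (s + T)%:R * rate.
Proof.
rewrite /irregular negb_or -leNgt => /andP[mixG countG].
have ov : forall x y, b%:R^-1 ^+ 13 <= overlap R G (lag l i) x y.
  by move=> x' y'; apply: overlap_lag mixG.
have small : (1 - b%:R^-1 ^+ 13) ^+ B <= 2^-1 ^+ b :> R.
  apply: (half_power (x := (b ^ 13)%N)); first by rewrite expn_gt0 b0.
    by rewrite /B -expnSr.
  rewrite exprVn natrX lexx /= invf_le1 ?exprn_gt0 ?ltr0n // exprn_ege1 // ler1n //.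
have h1 u v := expect2_contract (ltnW r2) B ov (avoid_bounds R (ltnW r2) G T) x y u v.
have h2 := sum_expect2_meet_count R (ltnW r2) G c0 s T.
rewrite -/(mean_meet_count R s T c0 G) in h2.
set E := expect2 G s (avoid R G T) in h2.
have h3 : (n * n)%:R * (E x y - 2 * 2^-1 ^+ b) <= \sum_u \sum_v E u v.
  have -> : (n * n)%:R * (E x y - 2 * 2^-1 ^+ b) = \sum_(u : V) \sum_(v : V) (E x y - 2 * 2^-1 ^+ b).
    by rewrite !sumr_const card_ord -mulrnA mulr_natl.
  apply: ler_sum => u _; apply: ler_sum => v _.
  by have := h1 u v; rewrite -/s -/E; lra.
apply: le_trans (avoid_expect2 R (ltnW r2) G s T x y) _; rewrite -/E.
have nR : 0 < n%:R :> R by rewrite ltr0n.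
have pw : 2 * 2^-1 ^+ b <= n%:R^-1 :> R.
  rewrite exprVn -[X in X <= _]mulrC ler_pdivrMl ?exprn_gt0 // ler_pdivlMr //.
  by rewrite -natrX -natrM ler_nat (leq_trans _ cb) // leq_mul2l nhi.
(* The losses are the burn-in, the relative deviation b^-2 of the count, and a final 1 for the
   mixing error 1/n; each is at most T / b^2. The factor b / (b + 1) saves about T / b. *)
have arith : (s + T)%:R * (b%:R / b.+1%:R) <= (1 - b%:R^-1 ^+ 2) * T%:R - 1 :> R.
  have pR : 1 <= (b ^ 15)%:R :> R by rewrite ler1n expn_gt0 b0.
  have sR : s%:R <= (b ^ 15)%:R :> R by rewrite ler_nat.
  have TR : T%:R = (b ^ 15)%:R * b%:R ^+ 2 :> R by rewrite -natrX -natrM -expnD.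
  rewrite natrD -[b.+1]addn1 (natrD _ b) TR.
  move: (b ^ 15)%:R s%:R b%:R pR sR bR => p s' z p1 s'p z400.
  rewrite mulrA ler_pdivrMr; last by lra.
  have -> : (1 - z^-1 ^+ 2) * (p * z ^+ 2) - 1 = p * z ^+ 2 - p - 1.
    by field; lra.
  have h1' : s' * z <= p * z by apply: ler_wpM2r => //; lra.
  have h2' : 400 * 400 <= z * z by apply: ler_pM => //; lra.
  have h3' : 400 * (p * z) <= p * z * z.
    by rewrite [400 * _]mulrC; apply: ler_wpM2l => //; apply: mulr_ge0; lra.
  have h4' : 400 * p <= p * z by rewrite mulrC; apply: ler_wpM2l => //; lra.
  have h5' : z <= p * z by rewrite ler_peMl //; lra.
  by rewrite expr2; lra.
rewrite -(ler_pM2l (x := (n * n)%:R)); last by rewrite ltr0n muln_gt0 n0.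
rewrite /rate.
have -> : (n * n)%:R * (1 - (s + T)%:R * (b%:R / b.+1%:R / n%:R)) =
   (n * n)%:R - n%:R * ((s + T)%:R * (b%:R / b.+1%:R)) :> R.
  by rewrite natrM; field; rewrite (lt0r_neq0 nR) andbT -(natrD R 1) pnatr_eq0.
have pw2 : (n * n)%:R * (2 * 2^-1 ^+ b) <= n%:R :> R.
  by rewrite natrM -mulrA ler_piMr // mulrC -ler_pdivlMr // div1r.
have := ler_wpM2l (ltW nR) arith.
have -> : n%:R * ((1 - b%:R^-1 ^+ 2) * T%:R - 1) = (1 - b%:R^-1 ^+ 2) * (T%:R * n%:R) - n%:R :> R.
  by ring.
move: h2 h3 pw2 countG; rewrite mulrBr.
move: (\sum_u _) (mean_meet_count _ _ _ _ _) ((n * n)%:R * E x y) ((n * n)%:R * _) (_ * (T%:R * n%:R)).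
move: (n%:R * (_ * _)) (n * n)%:R => *; lra.
Qed.

(** Bounds what [avoid_geometric] loses over one period, so the prefactor of the tail tends to 1. *)
Lemma lag_rate : (s + T)%:R * rate <= b%:R^-1.
Proof.
have nR : 0 < n%:R :> R by rewrite ltr0n.
have bR0 : 0 < b%:R :> R by rewrite ltr0n.
rewrite /rate mulrA ler_pdivrMr // ler_pdivlMl //.
apply: (@le_trans _ _ (b%:R * (s + T)%:R)).
  apply: ler_wpM2l => //; rewrite ler_piMr // ler_pdivrMr ?ltr0n // mul1r ler_nat //.
rewrite -natrM ler_nat (leq_trans _ nlo) //.
apply: (@leq_trans (b * (b * b ^ 17))).
  rewrite leq_mul2l; apply/orP; right.
  apply: (@leq_trans (b ^ 17 + b ^ 17)); first by rewrite leq_add2r (leq_trans s_le) // leq_exp2l // (leq_trans _ b400).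
  by rewrite addnn -mul2n leq_mul2r (leq_trans _ b400) ?orbT.
by rewrite -!expnS leq_exp2l // (leq_trans _ b400).
Qed.

Lemma rate_bounds : 0 < rate < 1.
Proof.
have nR : 0 < n%:R :> R by rewrite ltr0n.
have bR0 : 0 < b%:R :> R by rewrite ltr0n.
rewrite /rate !divr_gt0 ?ltr0n //= -mulrA -invfM ltr_pdivrMr ?mulr_gt0 ?ltr0n // mul1r.
by rewrite -natrM ltr_nat (leq_trans (ltnSn b)) // leq_pmulr.
Qed.

Lemma tail_regular (G : D) t x y : ~~ irregular G ->
  meet_tail R G x y t * (1 - b%:R^-1) <= (1 - rate) ^+ t.
Proof.
move=> reg; rewrite meet_tailE.
have := lag_rate; set q := _ * rate => hq.
have b1 : b%:R^-1 < 1 :> R by rewrite invf_lt1 ?ltr0n // ltr1n (leq_trans _ b400).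
apply: (@le_trans _ _ (avoid R G t x y * (1 - q))).
  by apply: ler_wpM2l; [case/andP: (avoid_bounds R (ltnW r2) G t x y) | lra].
case/andP: rate_bounds => [rate0 _].
apply: (avoid_geometric (ltnW r2)); [|exact: ltW|exact: le_lt_trans b1|].
  by rewrite addn_gt0 /T expn_gt0 b0 orbT.
by move=> u v; apply: avoid_regular.
Qed.

Lemma mean_irregular : mean (fun G : D => (irregular G)%:R) <=
  (r.+1 ^ i * (2 * (r * r.+1 ^ i)) ^ (r * r.+1 ^ i) + 3)%:R / b%:R
    + (r%:R ^+ 102) ^+ l / l`!%:R :> R.
Proof.
have T0 : (0 < T)%N by rewrite /T expn_gt0 b0.
have d0 : 0 < b%:R^-1 ^+ 2 :> R by rewrite exprn_gt0 // invr_gt0 ltr0n.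
have h1 := mean_unmixed R rn r2 nlo nhi b400 ek e1 ce cl ci lb.
have h2 := mean_low_count (R := R) rn (ltnW r2) s c0 T0 d0.
(* As s + T <= 2 b^17, the left side is at most 288 b^72 / n, and n >= b^100. *)
have h3 : (18 * (s + T) ^ 4)%:R / n%:R / b%:R^-1 ^+ 2 ^+ 2 <= b%:R^-1 :> R.
  rewrite !exprVn invrK -exprM mulrAC ler_pdivrMr ?ltr0n // ler_pdivlMl ?ltr0n //.
  rewrite -natrX -!natrM ler_nat (leq_trans _ nlo) //.
  apply: (@leq_trans (b * (b * (b ^ 17) ^ 4 * b ^ (2 * 2)))).
    rewrite leq_mul2l leq_mul2r; apply/orP; right; apply/orP; right.
    apply: (@leq_trans (18 * (2 * b ^ 17) ^ 4)).
      rewrite leq_mul2l leq_exp2r //= mul2n -addnn leq_add2r (leq_trans s_le) //.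
      by rewrite leq_exp2l // (leq_trans _ b400).
    by rewrite expnMn mulnA leq_mul2r (leq_trans _ b400) ?orbT.
  by rewrite -expnM -expnS -expnD -expnS leq_exp2l // (leq_trans _ b400).
apply: le_trans (mean_or h1 (le_trans h2 h3)) _.
by rewrite !natrD; lra.
Qed.

End ScaleTail.

(** * Asymptotics *)

From mathcomp Require Import all_classical all_reals all_analysis.
Import Order.TTheory GRing.Theory Num.Theory.
Import numFieldNormedType.Exports.

Local Open Scope classical_set_scope.
Local Open Scope ring_scope.

(** Raising m / q < 2^(m / q) to the power q = p + 1 gives m^q <= q^q 2^m up to rounding; the spare
    factor [m] then beats the constants. *)
Lemma pow_le_exp2 C p : exists N, forall m, (N <= m -> C * m ^ p <= 2 ^ m)%N.
Proof.
pose q := p.+1; pose c := (q ^ q)%N.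
have key m : (m ^ q <= c * 2 ^ m)%N.
  have h1 : (m %/ q < 2 ^ (m %/ q))%N by apply: ltn_expl.
  have h2 : (m <= q * 2 ^ (m %/ q))%N.
    rewrite {1}(divn_eq m q) mulnC; apply: (@leq_trans (q * (m %/ q).+1)).
      by rewrite mulnS addnC leq_add2r ltnW // ltn_pmod.
    by rewrite leq_mul2l h1 orbT.
  apply: (@leq_trans ((q * 2 ^ (m %/ q)) ^ q)); first by rewrite leq_exp2r.
  rewrite expnMn leq_mul2l -expnM leq_exp2l // leq_trunc_div.
  by rewrite orbT.
exists (C * c)%N => m Cm.
have c0 : (0 < c)%N by rewrite expn_gt0.
rewrite -(leq_pmul2l c0); apply: leq_trans (key m).
by rewrite expnS mulnA leq_mul2r [(c * C)%N]mulnC Cm orbT.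
Qed.

Section Law.
Variables (R : realType) (r : nat).

Lemma dfa_PrE n (E : pred (dfa n r)) : dfa_Pr R E = mean (fun G => (E G)%:R).
Proof.
have law (G : dfa n r) : dfa_law R G = #|{: dfa n r}|%:R^-1 :> R.
  by rewrite /dfa_law /uniform_law prodr_const card_ffun natrX exprVn !card_ord.
rewrite /dfa_Pr /mean mulr_sumr big_mkcond; apply: eq_bigr => G _.
by rewrite law; case: (E G); rewrite ?mulr1 ?mulr0.
Qed.

Lemma dfa_Pr_ge n (E B : pred (dfa n r)) (p : R) : (r <= n)%N ->
  (forall G, ~~ B G -> E G) -> mean (fun G => (B G)%:R) <= p -> 1 - p <= dfa_Pr R E <= 1.
Proof.
move=> rn BE Bp; rewrite dfa_PrE; apply/andP; split; last first.
  by rewrite -[X in _ <= X](mean1 R rn); apply: ler_mean => G; rewrite lern1 leq_b1.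
apply: (@le_trans _ _ (1 - mean (fun G => (B G)%:R))); first by rewrite lerD2l lerN2.
rewrite -[X in X - _](mean1 R rn) -meanB; apply: ler_mean => G.
have := BE G; case: (B G) => [_|->] //; last by rewrite subr0.
by rewrite subrr.
Qed.

End Law.

Section Main.
Variables (R : realType) (r : nat).
Hypothesis r2 : (2 <= r)%N.

Definition log_scale n := (trunc_log r n %/ 100)%N.
Definition scale n := (r ^ log_scale n)%N.
Definition meeting_rate n : R := (scale n)%:R / (scale n).+1%:R / n%:R.

Lemma log_scale_large N : \forall n \near \oo, (N <= log_scale n)%N.
Proof.
near=> n; rewrite /log_scale leq_divRL //; apply: trunc_log_max => //.
near: n; exact: nbhs_infty_ge.
Unshelve. all: by end_near.
Qed.

Lemma near_log_scale (P : nat -> Prop) :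
  (exists N, forall l, (N <= l)%N -> P l) -> \forall n \near \oo, P (log_scale n).
Proof.
move=> [N hN]; near=> n; apply: hN; near: n; exact: log_scale_large.
Unshelve. all: by end_near.
Qed.

Lemma scale_ge n : (0 < n)%N -> (scale n ^ 100 <= n)%N.
Proof.
move=> n0; apply: leq_trans (trunc_logP r2 n0).
by rewrite /scale -expnM leq_exp2l // leq_trunc_div.
Qed.

(** Rounding the logarithm down to a multiple of 100 loses at most 100, which one extra
    [log_scale n] makes up for. *)
Lemma scale_le n : (100 <= log_scale n)%N -> (n <= scale n ^ 101)%N.
Proof.
move=> l100; apply: ltnW; apply: leq_trans (trunc_log_ltn n r2) _.
rewrite /scale -expnM leq_exp2l //; move: l100; rewrite /log_scale.
have := ltn_ceil (trunc_log r n) (isT : (0 < 100)%N).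
move: (trunc_log r n) (trunc_log r n %/ 100)%N => x y; lia.
Qed.

Lemma near_log_scale_lt (u : nat -> R) (eps : R) : u @ \oo --> (0 : R) -> 0 < eps ->
  \forall n \near \oo, u (log_scale n) < eps.
Proof.
move=> /cvgrPdist_lt u0 eps0; apply: (near_log_scale (P := fun l => u l < eps)).
have [N _ hN] := u0 _ eps0; exists N => l /hN /=; rewrite sub0r normrN.
exact: le_lt_trans (ler_norm _).
Qed.

Lemma scale_inv_small (c eps : R) : 0 < eps ->
  \forall n \near \oo, c / (scale n)%:R < eps.
Proof.
move=> eps0; have r1 : `|r%:R^-1| < 1 :> R.
  by rewrite ger0_norm ?invr_ge0 // invf_lt1 ?ltr1n ?ltr0n // ltnW.
have := near_log_scale_lt (cvg_geometric c r1) eps0; apply: filterS => n.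
by rewrite /geometric /scale natrX /= exprVn.
Qed.

Lemma factorial_small (x eps : R) : 0 < eps ->
  \forall n \near \oo, x ^+ log_scale n / (log_scale n)`!%:R < eps.
Proof. by move=> eps0; apply: (near_log_scale_lt (cvg_exp_coeff x)). Qed.

Lemma near_scale_large (c : nat) : \forall n \near \oo, (c <= scale n)%N.
Proof.
apply: (near_log_scale (P := fun l => (c <= r ^ l)%N)); exists c => l cl.
apply: (leq_trans cl); apply: (leq_trans (ltnW (ltn_expl l (ltnSn 1)))).
by case: (posnP l) => [->|l0] //; rewrite leq_exp2r.
Qed.

Lemma near_scale_pow (c p : nat) : \forall n \near \oo, (c * (log_scale n).+1 ^ p <= scale n)%N.
Proof.
apply: (near_log_scale (P := fun l => (c * l.+1 ^ p <= r ^ l)%N)).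
have [N hN] := pow_le_exp2 (c * 2 ^ p) p; exists N.+1 => l Nl.
have l0 : (0 < l)%N by apply: leq_trans Nl.
apply: (@leq_trans (c * 2 ^ p * l ^ p)).
  rewrite -mulnA leq_mul2l -expnMn; apply/orP; right.
  by case: (p) => // q; rewrite leq_exp2r // mul2n -addnn -addn1 leq_add2l.
by apply: leq_trans (hN _ (ltnW Nl)) _; rewrite leq_exp2r.
Qed.

Lemma near_regular (eps : R) : 0 < eps ->
  \forall n \near \oo, exists B : pred (dfa n r),
    [/\ mean (fun G => (B G)%:R) < eps &
      forall G, ~~ B G -> forall t x y,
        meet_tail R G x y t * (1 - (scale n)%:R^-1) <= (1 - meeting_rate n) ^+ t].
Proof.
(* The depth [i] and e = 200 are fixed before [n], so every condition on them holds once [scale n]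
   is large. The value 200 is twice the 100 in [100 * log_scale n], as [expn_ratio_le] requires. *)
move=> eps0; have [i ek] : exists i, (2 * 100 * 205 <= 2 ^ i)%N.
  by exists (2 * 100 * 205)%N; apply: ltnW; apply: ltn_expl.
have eps2 : 0 < eps / 2 by rewrite divr_gt0.
pose C := (r.+1 ^ i * (2 * (r * r.+1 ^ i)) ^ (r * r.+1 ^ i) + 3)%N.
have [N2 hN2] := pow_le_exp2 2 101.
near=> n.
have hC : C%:R / (scale n)%:R < eps / 2 by near: n; exact: scale_inv_small.
have hF : (r%:R ^+ 102) ^+ log_scale n / (log_scale n)`!%:R < eps / 2.
  by near: n; exact: factorial_small.
have rn : (r <= n)%N by near: n; exact: nbhs_infty_ge.
have n0 : (0 < n)%N by rewrite (leq_trans _ rn) // ltnW.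
have l100 : (100 <= log_scale n)%N by near: n; exact: log_scale_large.
have b400 : (400 <= scale n)%N by near: n; exact: near_scale_large.
have ce : (4 * r ^ 2 * r.+1 ^ i.+1 * 2 ^ (2 * 100) <= scale n)%N by near: n; exact: near_scale_large.
have cl : (r.+1 ^ i.+1 * (log_scale n).+1 ^ i.+1 <= scale n)%N by near: n; exact: near_scale_pow.
have ci : (r ^ (i.+1 + i.+2) <= scale n)%N by near: n; exact: near_scale_large.
have lb : (100 * log_scale n + (i.+1 + i.+2) <= scale n)%N.
  have h : ((100 + (i.+1 + i.+2)) * (log_scale n).+1 ^ 1 <= scale n)%N by near: n; exact: near_scale_pow.
  by apply: leq_trans h; rewrite expn1; move: (log_scale n) => l; nia.
have cb : (2 * scale n ^ 101 <= 2 ^ scale n)%N.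
  by apply: hN2; near: n; exact: near_scale_large.
have eb j : (j <= 100 * log_scale n)%N -> ((2 * 100) ^ j <= r ^ log_scale n * (2 * 100).-1 ^ j)%N.
  by apply: expn_ratio_le.
exists (irregular R (log_scale n) i (2 * 100) r2); split.
  apply: le_lt_trans (mean_irregular R rn r2 (scale_ge n0) (scale_le l100) b400 ek isT ce cl ci lb) _.
  by rewrite -/C [eps]splitr; apply: ltrD.
move=> G reg t x y.
exact: (tail_regular rn (scale_ge n0) (scale_le l100) b400 ek isT eb ce cl ci lb cb t x y reg).
Unshelve. all: by end_near.
Qed.

End Main.

Theorem theorem2p1 (R : realType) (r : nat) (hr : (2 <= r)%N) :
  exists Lambda : forall n : nat, dfa n r -> R,
    [/\ forall n : nat, (r <= n)%N -> forall G : dfa n r, 0 < Lambda n G < 1,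
        cvg_in_prob (fun n G => Lambda n G * n%:R) (fun n G => 1)
      & forall eps : R, 0 < eps ->
          whp R (fun n (G : dfa n r) =>
            (ereal_sup (range (fun t : nat =>
               \big[maxe/-oo]_(x < n) \big[maxe/-oo]_(y < n)
                 (meet_tail R G x y t / (1 - Lambda n G) ^+ t)%:E))
             < (1 + eps)%:E)%E)].
Proof.
have rate_lt n : (r <= n)%N -> 0 < meeting_rate R r n < 1.
  move=> rn; have n0 : (0 < n)%N by rewrite (leq_trans _ rn) // ltnW.
  have b0 : (0 < scale r n)%N by rewrite expn_gt0 ltnW.
  have nR : 0 < n%:R :> R by rewrite ltr0n.
  rewrite /meeting_rate !divr_gt0 ?ltr0n //= -mulrA -invfM ltr_pdivrMr ?mulr_gt0 ?ltr0n // mul1r.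
  by rewrite -natrM ltr_nat (leq_trans (ltnSn _)) // leq_pmulr.
exists (fun n _ => meeting_rate R r n); split.
- by move=> n rn _; apply: rate_lt.
(* The rate is deterministic and [meeting_rate R r n * n%:R - 1] is -1/(b + 1), so the probability
   is eventually exactly 0. *)
- move=> eps eps0; apply: cvg_near_cst; near=> n.
  have inv_lt : 1 / (scale r n)%:R < eps by near: n; exact: scale_inv_small.
  have n0 : (0 < n)%N by near: n; exact: nbhs_infty_ge.
  have b0 : (0 < scale r n)%N by rewrite expn_gt0 ltnW.
  rewrite dfa_PrE (eq_mean (psi := fun=> 0)) => [|G].
    by rewrite /mean big1 ?mulr0.
  have bR : 0 < (scale r n)%:R :> R by rewrite ltr0n.
  have -> : meeting_rate R r n * n%:R - 1 = - (scale r n).+1%:R^-1.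
    rewrite /meeting_rate divfK ?pnatr_eq0 -?lt0n // -addn1 natrD.
    by field; rewrite -(natrD R _ 1) pnatr_eq0 addn1.
  rewrite normrN ger0_norm ?invr_ge0 // ltNge (le_trans _ (ltW inv_lt)) // div1r.
  by rewrite lef_pV2 ?posrE ?ltr0n // ler_nat.
move=> eps eps0; apply/cvgrPdist_lt => e e0; near=> n.
have inv_lt : (1 + eps) / (scale r n)%:R < eps by near: n; exact: scale_inv_small.
have rn : (r <= n)%N by near: n; exact: nbhs_infty_ge.
have [B [Be hB]] : exists B : pred (dfa n r), [/\ mean (fun G => (B G)%:R) < e &
    forall G, ~~ B G -> forall t x y,
      meet_tail R G x y t * (1 - (scale r n)%:R^-1) <= (1 - meeting_rate R r n) ^+ t].
  by near: n; exact: near_regular.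
set P := dfa_Pr R _; suff /andP[P1 P2] : 1 - mean (fun G => (B G)%:R : R) <= P <= 1.
  by rewrite ger0_norm; lra.
apply: (dfa_Pr_ge rn _ (lexx _)) => G /hB tail.
(* One constant [c < 1 + eps] bounds the ratio for all [t], [x] and [y], so the supremum is strictly
   below [1 + eps]. *)
set c : R := (1 - (scale r n)%:R^-1)^-1.
have gt1 : 1 < (1 + eps) * (1 - (scale r n)%:R^-1) by rewrite mulrBr mulr1; lra.
have c1 : 0 < 1 - (scale r n)%:R^-1 :> R.
  by rewrite -(pmulr_rgt0 _ (x := 1 + eps)) ?(lt_trans _ gt1) //; lra.
have ceps : c < 1 + eps by rewrite /c -div1r ltr_pdivrMr.
have /andP[rate0 rate1] := rate_lt n rn.
apply: (@le_lt_trans _ _ c%:E); last by rewrite lte_fin.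
apply: ge_ereal_sup => _ [t _ <-].
apply: bigmax_le => [|x _]; first exact: leNye.
apply: bigmax_le => [|y _]; first exact: leNye.
rewrite lee_fin ler_pdivrMr ?exprn_gt0 ?subr_gt0 //.
by rewrite /c mulrC ler_pdivlMr.
Unshelve. all: by end_near.
Qed.
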